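(* Let $\mathcal P$ be a good grid of a finite measure space $(I,\mathbb A,m)$, $p\in[1,\infty)$, $q\in[1,\infty]$ and $0<s<1/p$. Let $g:\mathbb C\to\mathbb C$ be a Lipschitz function such that $g(0)=0$. Then the left composition $L_g:\mathcal B^s_{p,q}\to\mathcal B^s_{p,q}$ defined by $L_g(f)=g\circ f$ is well-defined and $$|g\circ f|_p+osc^s_{p,q}(g\circ f)\le K\,(|f|_p+osc^s_{p,q}(f)),$$ where $K$ is the Lipschitz constant of $g$. Consequently there exists $C$ such that $$|L_g(f)|_{\mathcal B^s_{p,q}}\le C|f|_{\mathcal B^s_{p,q}}$$ for every $f\in\mathcal B^s_{p,q}$.
   Context: $|J|=m(J)$; $\mathbb N=\{0,1,\dots\}$; sup modification when $q=\infty$. Good grid: for some $0<\lambda_1<\lambda_2<1$, a sequence $\mathcal P=(\mathcal P^k)_{k\in\mathbb N}$ of finite families of measurable sets of positive measure with: $\mathcal P^0=\{I\}$; $I=\bigcup_{Q\in\mathcal P^k}Q$ up to a null set; the elements of $\mathcal P^k$ are pairwise disjoint; every $Q\in\mathcal P^k$, $k>0$, is contained in some $P\in\mathcal P^{k-1}$; $\lambda_1\le|Q|/|P|\le\lambda_2$ whenever $Q\subset P$, $Q\in\mathcal P^{k+1}$, $P\in\mathcal P^k$; $\bigcup_k\mathcal P^k$ generates $\mathbb A$. An $(s,p)$-Souza's atom on $Q\in\bigcup_k\mathcal P^k$ is a function constant on $Q$, zero outside $Q$, with sup norm $\le|Q|^{s-1/p}$. $\mathcal B^s_{p,q}$ is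 the set of complex $f\in L^p$ which can be written $f=\sum_k\sum_{Q\in\mathcal P^k}s_Qa_Q$ with $a_Q$ an $(s,p)$-Souza's atom on $Q$, $s_Q\in\mathbb C$, $\sum_k|\sum_{Q\in\mathcal P^k}s_Qa_Q|_p<\infty$ and finite cost $(\sum_k(\sum_{Q\in\mathcal P^k}|s_Q|^p)^{q/p})^{1/q}$; $|f|_{\mathcal B^s_{p,q}}$ is the infimum of the costs. $osc_p(f,Q)=\inf_{c\in\mathbb C}(\int_Q|f-c|^p\,dm)^{1/p}$ and $osc^s_{p,q}(f)=\big(\sum_k(\sum_{Q\in\mathcal P^k}|Q|^{-sp}osc_p(f,Q)^p)^{q/p}\big)^{1/q}$. *)

(* Defs.v *)
From HB Require Import structures.
From mathcomp Require Import all_boot all_order all_algebra.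
From mathcomp Require Import all_classical all_reals all_analysis.
From mathcomp Require Export complex.
Import Order.TTheory GRing.Theory Num.Theory.
Import numFieldNormedType.Exports.

Set Implicit Arguments.
Unset Strict Implicit.
Unset Printing Implicit Defensive.

Local Open Scope classical_set_scope.
Local Open Scope ring_scope.

(* The modulus is [Normc.normc : R[i] -> R]; the norm [`|z|] of [R[i]] takes
   its values in [R[i]]. *)
Notation normc := ComplexField.Normc.normc.

(* [P] is a sequence of families of subsets of [T], the whole type [T] being
   the space I. *)
Record is_grid (d : measure_display) (T : measurableType d) (R : realType)
    (mu : {measure set T -> \bar R}) (l1 l2 : R) (P : nat -> set (set T)) :
    Prop := IsGrid {
  grid_finite : forall k, finite_set (P k);
  grid_measurable : forall k Q, P k Q -> measurable Q;
  grid_gt0 : forall k Q, P k Q -> (0 < mu Q)%E;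
  grid0 : P 0%N = [set setT];
  grid_cover : forall k, mu (~` \bigcup_(Q in P k) Q) = 0%E;
  grid_disjoint : forall k, trivIset (P k) id;
  grid_nested : forall k Q, P k.+1 Q -> exists2 W, P k W & Q `<=` W;
  grid_ratio : forall k Q W, P k.+1 Q -> P k W -> Q `<=` W ->
    l1 <= fine (mu Q) / fine (mu W) <= l2;
  grid_generates : <<s \bigcup_k P k >> = measurable }.

Definition good_grid (d : measure_display) (T : measurableType d)
    (R : realType) (mu : {measure set T -> \bar R}) (P : nat -> set (set T)) :
    Prop :=
  exists l1 l2 : R, [/\ 0 < l1, l1 < l2, l2 < 1 & is_grid mu l1 l2 P].

Section Besov.
Context (d : measure_display) (T : measurableType d) (R : realType).
Variable mu : {measure set T -> \bar R}.
Implicit Types (f : T -> R[i]) (p s : R) (q : \bar R).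

Definition cmeasurable f : Prop :=
  measurable_fun setT (fun x => complex.Re (f x)) /\
  measurable_fun setT (fun x => complex.Im (f x)).

Definition cLnorm p f : \bar R := Lnorm mu p%:E (fun x => (normc (f x))%:E).

Definition cLp p f : Prop := cmeasurable f /\ (cLnorm p f < +oo)%E.

(* (sum_k (A k)^(q/p))^(1/q), read as sup_k (A k)^(1/p) when q = +oo; only
   q >= 1 is meaningful. *)
Definition mixed_norm p q (A : nat -> \bar R) : \bar R :=
  match q with
  | r%:E => (\sum_(k <oo) A k `^ (r / p)) `^ r^-1
  | +oo => ereal_sup (range (fun k => A k `^ p^-1))
  | -oo => 0
  end%E.

Definition souza_atom s p (Q : set T) (a : T -> R[i]) : Prop :=
  [/\ exists c, forall x, Q x -> a x = c,
      forall x, ~ Q x -> a x = 0 &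
      forall x, normc (a x) <= fine (mu Q) `^ (s - p^-1)].

Variable P : nat -> set (set T).

Definition layer (c : nat -> set T -> R[i]) (a : nat -> set T -> T -> R[i])
    (k : nat) (x : T) : R[i] :=
  \sum_(Q \in P k) c k Q * a k Q x.

Definition besov_cost p q (c : nat -> set T -> R[i]) : \bar R :=
  mixed_norm p q (fun k => \sum_(Q \in P k) ((normc (c k Q)) `^ p)%:E)%E.

(* The equality f = sum_k layer_k is that of L^p, where the series converges
   absolutely. *)
Definition besov_rep s p q f (c : nat -> set T -> R[i])
    (a : nat -> set T -> T -> R[i]) : Prop :=
  [/\ forall k Q, P k Q -> souza_atom s p Q (a k Q),
      (\sum_(k <oo) cLnorm p (layer c a k) < +oo)%E,
      cLnorm p (fun x => f x - \sum_(0 <= k < n) layer c a k x)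
        @[n --> \oo] --> 0%E &
      (besov_cost p q c < +oo)%E].

Definition besov s p q : set (T -> R[i]) :=
  [set f | cLp p f /\ exists c a, besov_rep s p q f c a].

Definition besov_norm s p q f : \bar R :=
  ereal_inf [set v | exists c a, besov_rep s p q f c a /\
                                 v = besov_cost p q c].

Definition osc p f (Q : set T) : \bar R :=
  ereal_inf (range (fun c : R[i] =>
    (\int[mu]_(x in Q) ((normc (f x - c)) `^ p)%:E) `^ p^-1))%E.

Definition besov_osc s p q f : \bar R :=
  mixed_norm p q (fun k =>
    \sum_(Q \in P k) (fine (mu Q) `^ (- (s * p)))%:E * osc p f Q `^ p)%E.

End Besov.

Definition lipschitz_bounds (R : realType) (g : R[i] -> R[i]) : set R :=
  [set k | forall z w, normc (g z - g w) <= k * normc (z - w)].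

Definition lipschitz_constant (R : realType) (g : R[i] -> R[i]) : R :=
  inf (lipschitz_bounds g).

(* Main.v *)
(* The Besov cost of [f] is equivalent to [cLnorm f + besov_osc f]; the
   latter is multiplied by at most [K] under composition with a K-Lipschitz map
   fixing 0, because [osc (g \o f) Q] is estimated by the constants [g c].

   Cost bounds oscillation: on an element of level k the partial sum of the
   layers up to k is constant, so the oscillation is controlled by the tail.
   All estimates are made on p-th powers of integrals, where the factor
   [|Q| ^ s], geometric in the level, replaces Minkowski's inequality.

   Oscillation bounds cost: choose a near-optimal constant [e Q] on every
   element; the layer of level k is the difference between these constants on
   an element and on its parent.  The partial sums converge to [f] in L^p at a
   geometric rate, so no martingale convergence is needed. *)
Require Import Defs.
From mathcomp Require Import all_boot all_order all_algebra.
From mathcomp Require Import finmap.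
From mathcomp Require Import all_classical all_reals all_analysis.
From mathcomp Require Import measurable_realfun ring lra.
Import Order.TTheory GRing.Theory Num.Theory.
Import numFieldNormedType.Exports.

Set Implicit Arguments.
Unset Strict Implicit.
Unset Printing Implicit Defensive.

Local Open Scope classical_set_scope.
Local Open Scope ring_scope.

(** * Powers of extended reals and mixed norms *)

(** The obstacle is that cells are summed in l^p and levels in l^q, with q on either side of p. The
    p-th power of an integral is additive over cells, so it can be regrouped from one level to
    another, but it is not subadditive in the function. The remedy is to spend part of the geometric
    decay: for every exponent t > 0, the t-th power of a series with weights z^n is at most a
    constant times the series of t-th powers with weights w^n, for another w < 1. With t = p,
    applied pointwise, this splits a sum of layers; with t = r/p (or 1/p for q infinite) it bounds
    mixed norms without distinguishing r < p from r > p. The upper ratio [l2] supplies the decay;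
    the lower ratio [l1] compares the weight of a cell with that of its parent. The constants lost
    in this way affect the equivalence of norms alone: the first estimate of the theorem is termwise
    and keeps the Lipschitz constant. *)

Section ereal_powers.
Context (R : realType).
Implicit Types (x y z : \bar R) (t u : R).
Local Open Scope ereal_scope.

Lemma le_poweR t x y : (0 <= t)%R -> 0 <= x -> x <= y -> x `^ t <= y `^ t.
Proof.
move=> t0 x0 xy; apply: gt0_ler_poweR => //; rewrite in_itv/= leey andbT//.
exact: le_trans xy.
Qed.

Lemma poweRK t x : (0 < t)%R -> 0 <= x -> (x `^ t) `^ t^-1 = x.
Proof. by move=> t0 x0; rewrite -poweRrM mulfV ?gt_eqF// poweRe1. Qed.

Lemma poweRVK t x : (0 < t)%R -> 0 <= x -> (x `^ t^-1) `^ t = x.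
Proof. by move=> t0 x0; rewrite -poweRrM mulVf ?gt_eqF// poweRe1. Qed.

Lemma poweR_le_root t x y : (0 < t)%R -> 0 <= x -> x `^ t <= y -> x <= y `^ t^-1.
Proof.
move=> t0 x0 xy; rewrite -(poweRK t0 x0); apply: le_poweR => //.
  by rewrite invr_ge0 ltW.
exact: poweR_ge0.
Qed.

Lemma poweR_le_pow t x y : (0 < t)%R -> 0 <= x -> x `^ t^-1 <= y -> x <= y `^ t.
Proof.
by move=> t0 x0; rewrite -{2}[t]invrK; apply: poweR_le_root; rewrite ?invr_gt0.
Qed.

Lemma powR_exprn (a t : R) n : (0 <= a)%R -> ((a ^+ n) `^ t = (a `^ t) ^+ n)%R.
Proof.
by move=> a0; rewrite -powR_mulrn// -powRrM mulrC powRrM powR_mulrn ?powR_ge0.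
Qed.

(** A sum is at most twice its larger term. No convexity is involved, so exponents on both sides of
    1 are allowed; [p] and [r^-1] both occur below. *)
Lemma poweRD_le u x y : (0 <= u)%R -> 0 <= x -> 0 <= y ->
  (x + y) `^ u <= (2 `^ u)%:E * (x `^ u + y `^ u).
Proof.
move=> u0; wlog xy : x y / x <= y => [wh|] x0 y0.
  have [/wh|/ltW/wh] := leP x y; first exact.
  by rewrite addeC [_ `^ _ + _]addeC; exact.
have h : x + y <= 2%:E * y.
  by rewrite -[2%R]/((1 + 1)%R) EFinD ge0_muleDl ?mul1e ?leeD2r// ?lee_fin.
apply: (le_trans (le_poweR u0 (adde_ge0 x0 y0) h)).
by rewrite poweRM ?lee_fin// lee_wpmul2l ?lee_fin ?powR_ge0// leeDr// poweR_ge0.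
Qed.

Lemma nneseries_geometric (z : R) : (0 <= z)%R -> (z < 1)%R ->
  \sum_(n <oo) (z ^+ n)%:E = ((1 - z)^-1)%:E.
Proof.
move=> z0 z1; apply/cvg_lim => //.
have -> : (fun n => \sum_(0 <= k < n) (z ^+ k)%:E) =
    EFin \o series (geometric 1%R z).
  apply/funext => n /=; rewrite sumEFin /series/=; congr EFin.
  by apply: eq_bigr => i _; rewrite mul1r.
apply: cvg_EFin; first exact: nearW.
by rewrite -[X in _ --> X]mul1r; apply: cvg_geometric_series; rewrite ger0_norm.
Qed.

Lemma nneseries_ge_term (u_ : nat -> \bar R) n : (forall i, 0 <= u_ i) ->
  u_ n <= \sum_(i <oo) u_ i.
Proof.
move=> u0; apply: le_trans (nneseries_lim_ge n.+1 _) => //.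
by rewrite big_nat_recr//= leeDr// sume_ge0.
Qed.

(* Writing [z ^ n = w ^ n * w ^ n], the series is at most
   [sup_n (w ^ n * x n)] times a geometric series, and the t-th power of this
   supremum is at most the series of the t-th powers. *)
Lemma geometric_poweR_le t (z : R) : (0 < t)%R -> (0 < z < 1)%R ->
  exists C w : R, [/\ (0 < C)%R, (0 < w < 1)%R & forall x : nat -> \bar R,
    (forall n, 0 <= x n) ->
    (\sum_(n <oo) (z ^+ n)%:E * x n) `^ t <=
      C%:E * \sum_(n <oo) (w ^+ n)%:E * x n `^ t].
Proof.
move=> t0 /andP[z0 z1]; set w := Num.sqrt z.
have w0 : (0 < w)%R by rewrite sqrtr_gt0.
have w1 : (w < 1)%R by rewrite -sqrtr1 ltr_sqrt.
exists (((1 - w)^-1) `^ t)%R, (w `^ t)%R; split.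
- by rewrite powR_gt0// invr_gt0 subr_gt0.
- rewrite powR_gt0//=.
  have -> : 1%R = (1 `^ t)%R :> R by rewrite powR1.
  by apply: gt0_ltr_powR => //; rewrite nnegrE ltW.
move=> x x0; set Z := \sum_(n <oo) ((w `^ t)%R ^+ n)%:E * x n `^ t.
have a0 n : 0 <= ((w `^ t)%R ^+ n)%:E * x n `^ t.
  by rewrite mule_ge0 ?poweR_ge0// lee_fin exprn_ge0 ?powR_ge0.
have Z0 : 0 <= Z by apply: nneseries_ge0.
have [->|Zy] := eqVneq Z +oo.
  by rewrite gt0_muley ?leey// lte_fin powR_gt0// invr_gt0 subr_gt0.
have Zfin : Z `^ t^-1 \is a fin_num.
  by apply: fin_num_poweR; rewrite ge0_fin_numE// ltey.
have h n : (z ^+ n)%:E * x n <= Z `^ t^-1 * (w ^+ n)%:E.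
  have -> : z = (w * w)%R by rewrite -expr2 sqr_sqrtr ?ltW.
  rewrite exprMn EFinM -muleA muleC; apply: lee_wpmul2r.
    by rewrite lee_fin exprn_ge0 ?ltW.
  apply: poweR_le_root => //; first by rewrite mule_ge0// lee_fin exprn_ge0 ?ltW.
  rewrite poweRM ?lee_fin ?exprn_ge0 ?(ltW w0)//.
  rewrite poweR_EFin powR_exprn ?(ltW w0)//.
  exact: nneseries_ge_term.
have h2 : \sum_(n <oo) (z ^+ n)%:E * x n <= ((1 - w)^-1)%:E * Z `^ t^-1.
  rewrite -nneseries_geometric ?(ltW w0)// muleC.
  apply: le_trans (lee_nneseries (v := fun n => Z `^ t^-1 * (w ^+ n)%:E) _ _) _.
  - by move=> i _ _; rewrite mule_ge0// lee_fin exprn_ge0 ?ltW.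
  - by move=> n _; exact: h.
  - rewrite -(fineK Zfin) nneseriesZl// => n _.
    by rewrite lee_fin exprn_ge0 ?ltW.
have s0 : 0 <= \sum_(n <oo) (z ^+ n)%:E * x n.
  by apply: nneseries_ge0 => n _ _; rewrite mule_ge0// lee_fin exprn_ge0 ?ltW.
apply: (le_trans (le_poweR (ltW t0) s0 h2)).
rewrite poweRM ?poweR_ge0//; last by rewrite lee_fin invr_ge0 subr_ge0 ltW.
by rewrite poweR_EFin poweRVK.
Qed.

Lemma nneseries_shift_le (u_ : nat -> \bar R) n : (forall i, 0 <= u_ i) ->
  \sum_(k <oo) u_ (k + n)%N <= \sum_(k <oo) u_ k.
Proof.
move=> u0; rewrite nneseries_addn// (@nneseries_split _ u_ 0%N n)//.
by rewrite add0n leeDr// sume_ge0.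
Qed.

End ereal_powers.

(** * Inequalities for mixed norms *)

Section mixed_norm_theory.
Context (R : realType).
Implicit Types (p q K M z : R) (A B : nat -> \bar R).
Local Open Scope ereal_scope.

Lemma mixed_norm_ge0 p (q : \bar R) A : 0 <= mixed_norm p q A.
Proof.
case: q => [r| |] //=; first exact: poweR_ge0.
by apply: le_trans (ereal_sup_ubound _); [|exists 0%N; reflexivity]; exact: poweR_ge0.
Qed.

(** The entries are p-th powers, hence the factor K^p on them. Nothing is lost in [K], which the
    first estimate of the theorem requires. *)
Lemma mixed_norm_scale p (q : \bar R) K A B : (0 < p)%R -> 1 <= q -> (0 <= K)%R ->
  (forall k, 0 <= A k) -> (forall k, 0 <= B k) ->
  (forall k, A k <= (K `^ p)%:E * B k) ->
  mixed_norm p q A <= K%:E * mixed_norm p q B.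
Proof.
move=> p0 + K0 A0 B0 AB; case: q => [r| |]//=; last first.
  move=> _; apply: ge_ereal_sup => _ [k _ <-].
  apply: (@le_trans _ _ (K%:E * B k `^ p^-1)); last first.
    by apply: lee_wpmul2l; [rewrite lee_fin|apply: ereal_sup_ubound; exists k].
  apply: le_trans (le_poweR _ (A0 k) (AB k)) _; first by rewrite invr_ge0 ltW.
  rewrite poweRM ?lee_fin ?powR_ge0// poweR_EFin -powRrM mulfV ?gt_eqF//.
  by rewrite powRr1.
rewrite lee_fin => r1; have r0 : (0 < r)%R by apply: lt_le_trans r1.
have t0 : (0 < r / p)%R by rewrite divr_gt0.
have h k : A k `^ (r / p) <= (K `^ r)%:E * B k `^ (r / p).
  apply: le_trans (le_poweR (ltW t0) (A0 k) (AB k)) _.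
  rewrite poweRM ?lee_fin ?powR_ge0// poweR_EFin -powRrM.
  by rewrite mulrCA mulfV ?gt_eqF// mulr1.
have h2 : \sum_(k <oo) A k `^ (r / p) <= (K `^ r)%:E * \sum_(k <oo) B k `^ (r / p).
  rewrite -nneseriesZl; last by move=> k _; exact: poweR_ge0.
  by apply: lee_nneseries => [k _ _|k _]; [exact: poweR_ge0|exact: h].
have ri0 : (0 <= r^-1)%R by rewrite invr_ge0 ltW.
have s0 C : 0 <= \sum_(k <oo) C k `^ (r / p).
  by apply: nneseries_ge0 => k _ _; exact: poweR_ge0.
apply: le_trans (le_poweR ri0 (s0 _) h2) _.
rewrite poweRM ?lee_fin ?powR_ge0// poweR_EFin -powRrM mulfV ?gt_eqF//.
by rewrite powRr1.
Qed.

(** The embedding of l^q into l^oo; it extracts a single level from a cost or an oscillation. *)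
Lemma mixed_norm_ge_term p (q : \bar R) A k : (0 < p)%R -> 1 <= q ->
  (forall k, 0 <= A k) -> A k `^ p^-1 <= mixed_norm p q A.
Proof.
move=> p0 + A0; case: q => [r| |]//=; last first.
  by move=> _; apply: ereal_sup_ubound; exists k.
rewrite lee_fin => r1; have r0 : (0 < r)%R by apply: lt_le_trans r1.
apply: poweR_le_root => //; first exact: poweR_ge0.
rewrite -poweRrM mulrC; apply: (@nneseries_ge_term _ (fun k => A k `^ (r / p))).
by move=> i; exact: poweR_ge0.
Qed.

(** A discrete Hardy inequality: each entry of [A] is controlled by the later entries of [B] with
    geometric weights. [geometric_poweR_le] moves the outer power inside the series, with exponent
    r/p, or 1/p when q is infinite; what is left is linear in the powers of [B]. *)
Lemma mixed_norm_geometric p (q : \bar R) z M : (0 < p)%R -> 1 <= q ->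
  (0 < z < 1)%R -> (0 < M)%R ->
  exists2 C : R, (0 < C)%R & forall A B,
    (forall k, 0 <= A k) -> (forall k, 0 <= B k) ->
    (forall k, A k <= M%:E * \sum_(n <oo) (z ^+ n)%:E * B (k + n)%N) ->
    mixed_norm p q A <= C%:E * mixed_norm p q B.
Proof.
move=> p0 + z01 M0; have z0 : (0 <= z)%R by case/andP: z01 => /ltW.
have core t : (0 < t)%R -> exists C w : R, [/\ (0 < C)%R, (0 < w < 1)%R &
  forall A B, (forall k, 0 <= A k) -> (forall k, 0 <= B k) ->
    (forall k, A k <= M%:E * \sum_(n <oo) (z ^+ n)%:E * B (k + n)%N) ->
    forall k, A k `^ t <= C%:E * \sum_(n <oo) (w ^+ n)%:E * B (k + n)%N `^ t].
  move=> t0; have [C [w [C0 w01 h]]] := geometric_poweR_le t0 z01.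
  exists (M `^ t * C)%R, w; split => //; first by rewrite mulr_gt0// powR_gt0.
  move=> A B A0 B0 AB k; apply: le_trans (le_poweR (ltW t0) (A0 k) (AB k)) _.
  have s0 : 0 <= \sum_(n <oo) (z ^+ n)%:E * B (k + n)%N.
    by apply: nneseries_ge0 => n _ _; rewrite mule_ge0// lee_fin exprn_ge0.
  rewrite poweRM ?lee_fin ?(ltW M0)// poweR_EFin EFinM -muleA.
  by apply: lee_wpmul2l; [rewrite lee_fin powR_ge0|exact: h].
case: q => [r| |]//=; last first.
  move=> _; have [|C [w [C0 /andP[w0 w1] h]]] := core p^-1%R; first by rewrite invr_gt0.
  exists (C * (1 - w)^-1)%R; first by rewrite mulr_gt0// invr_gt0 subr_gt0.
  move=> A B A0 B0 AB; apply: ge_ereal_sup => _ [k _ <-].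
  apply: le_trans (h _ _ A0 B0 AB k) _; rewrite EFinM -muleA.
  apply: lee_wpmul2l; first by rewrite lee_fin ltW.
  set S := ereal_sup _.
  have BS j : B j `^ p^-1 <= S by apply: ereal_sup_ubound; exists j.
  have S0 : 0 <= S by apply: le_trans (BS 0%N); exact: poweR_ge0.
  have [->|Sy] := eqVneq S +oo.
    by rewrite gt0_muley ?leey// lte_fin invr_gt0 subr_gt0.
  have Sfin : S \is a fin_num by rewrite ge0_fin_numE// ltey.
  rewrite -nneseries_geometric ?(ltW w0)// muleC -(fineK Sfin) -nneseriesZl; last first.
    by move=> n _; rewrite lee_fin exprn_ge0 ?ltW.
  apply: lee_nneseries => [n _ _|n _].
    by rewrite mule_ge0 ?poweR_ge0// lee_fin exprn_ge0 ?ltW.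
  by rewrite fineK// muleC; apply: lee_wpmul2r; rewrite ?lee_fin ?exprn_ge0 ?(ltW w0).
rewrite lee_fin => r1; have r0 : (0 < r)%R by apply: lt_le_trans r1.
have t0 : (0 < r / p)%R by rewrite divr_gt0.
have [C [w [C0 /andP[w0 w1] h]]] := core _ t0.
have G0 : (0 < C * (1 - w)^-1)%R by rewrite mulr_gt0// invr_gt0 subr_gt0.
exists ((C * (1 - w)^-1) `^ r^-1)%R; first by rewrite powR_gt0.
move=> A B A0 B0 AB; set t := (r / p)%R in t0 h *.
set S := \sum_(k <oo) B k `^ t.
have S0 : 0 <= S by apply: nneseries_ge0 => k _ _; exact: poweR_ge0.
have wn n : 0 <= (w ^+ n)%:E :> \bar R by rewrite lee_fin exprn_ge0 ?ltW.
suff h2 : \sum_(k <oo) A k `^ t <= (C * (1 - w)^-1)%:E * S.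
  apply: le_trans (le_poweR _ _ h2) _; first by rewrite invr_ge0 ltW.
    by apply: nneseries_ge0 => k _ _; exact: poweR_ge0.
  by rewrite poweRM// lee_fin ltW.
apply: (@le_trans _ _ (\sum_(k <oo) C%:E * \sum_(n <oo) (w ^+ n)%:E * B (k + n)%N `^ t)).
  by apply: lee_nneseries => [k _ _|k _]; [exact: poweR_ge0|exact: h].
have b0 k n : 0 <= (w ^+ n)%:E * B (k + n)%N `^ t.
  by rewrite mule_ge0 ?poweR_ge0.
rewrite nneseriesZl; last by move=> k _; apply: nneseries_ge0.
rewrite EFinM -muleA; apply: lee_wpmul2l; first by rewrite lee_fin ltW.
(* With the sum over [k] inside, each inner series is a tail of [S], and the remaining weights w^n
   sum to 1/(1 - w). *)
rewrite (nneseries_interchange (a := fun k n => (w ^+ n)%:E * B (k + n)%N `^ t))//.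
have [->|Sy] := eqVneq S +oo.
  by rewrite gt0_muley ?leey// lte_fin invr_gt0 subr_gt0.
have Sfin : S \is a fin_num by rewrite ge0_fin_numE// ltey.
rewrite -nneseries_geometric ?(ltW w0)// muleC -(fineK Sfin) -nneseriesZl; last first.
  by move=> n _.
apply: lee_nneseries => [n _ _|n _].
  by apply: nneseries_ge0 => k _ _.
rewrite nneseriesZl; last by move=> k _; exact: poweR_ge0.
rewrite fineK// muleC; apply: lee_wpmul2r => //.
by apply: (@nneseries_shift_le _ (fun k => B k `^ t)) => k; exact: poweR_ge0.
Qed.

(** Meant for the sequence that starts with the p-th power of the L^p norm and continues with the
    oscillation terms. *)
Lemma mixed_norm_cons p (q : \bar R) : (0 < p)%R -> 1 <= q ->
  exists2 C : R, (0 < C)%R & forall A, (forall k, 0 <= A k) ->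
    mixed_norm p q A <= C%:E * (A 0%N `^ p^-1 + mixed_norm p q (A \o S)).
Proof.
move=> p0; case: q => [r| |]//=; last first.
  move=> _; exists 1%R => // A A0; rewrite mul1e.
  have S0 : 0 <= ereal_sup (range (fun k => A k.+1 `^ p^-1)).
    exact: (mixed_norm_ge0 p +oo (A \o S)).
  apply: ge_ereal_sup => _ [[|k] _ <-]; first by rewrite leeDl.
  rewrite (@le_trans _ _ (ereal_sup (range (fun k => A k.+1 `^ p^-1))))//.
    by apply: ereal_sup_ubound; exists k.
  by rewrite leeDr// poweR_ge0.
rewrite lee_fin => r1; have r0 : (0 < r)%R by apply: lt_le_trans r1.
exists (2 `^ r^-1)%R; first by rewrite powR_gt0.
move=> A A0; have ri0 : (0 <= r^-1)%R by rewrite invr_ge0 ltW.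
have a0 k : 0 <= A k `^ (r / p) by exact: poweR_ge0.
rewrite nneseries_recl// -(@nneseries_addn _ (fun k => A k `^ (r / p)) 1)//.
under eq_eseriesr do rewrite addn1.
apply: le_trans (poweRD_le _ _ _) _ => //; first exact: nneseries_ge0.
by rewrite -poweRrM mulrAC mulfV ?gt_eqF// mul1r.
Qed.

End mixed_norm_theory.

(** * Measurable complex functions *)

Section complex_modulus.
Context (R : realType).
Implicit Types z w : R[i].

Lemma normc_ge0 z : 0 <= normc z.
Proof. by case: z => a b; exact: sqrtr_ge0. Qed.

Lemma normcD_le z w : normc (z + w) <= normc z + normc w.
Proof. exact: (@le_normcD R z w). Qed.

Lemma normc_opp z : normc (- z) = normc z.
Proof. exact: (@normcN R z). Qed.

Lemma normc_distC z w : normc (z - w) = normc (w - z).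
Proof. by rewrite -normc_opp opprB. Qed.

Lemma normc_distD_le (v z w : R[i]) : normc (z - w) <= normc (z - v) + normc (v - w).
Proof. by rewrite (le_trans _ (normcD_le _ _))// addrA subrK. Qed.

Lemma normc_real (a : R) : 0 <= a -> normc (a +i* 0)%C = a.
Proof. by move=> a0 /=; rewrite expr0n addr0 sqrtr_sqr ger0_norm. Qed.

Lemma normc_sum_le (I : Type) (r : seq I) (F : I -> R[i]) :
  normc (\sum_(i <- r) F i) <= \sum_(i <- r) normc (F i).
Proof.
elim: r => [|i r ih]; first by rewrite !big_nil ComplexField.Normc.normc0.
by rewrite !big_cons (le_trans (normcD_le _ _))// lerD2l.
Qed.

Lemma ReB z w : complex.Re (z - w) = complex.Re z - complex.Re w.
Proof. by case: z w => [a b] [c d]. Qed.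

Lemma ImB z w : complex.Im (z - w) = complex.Im z - complex.Im w.
Proof. by case: z w => [a b] [c d]. Qed.

Lemma Re_le_normc z : `|complex.Re z| <= normc z.
Proof. by case: z => a b /=; rewrite -sqrtr_sqr ler_wsqrtr// lerDl sqr_ge0. Qed.

Lemma Im_le_normc z : `|complex.Im z| <= normc z.
Proof. by case: z => a b /=; rewrite -sqrtr_sqr ler_wsqrtr// lerDr sqr_ge0. Qed.

Lemma normc_le_ReIm z : normc z <= `|complex.Re z| + `|complex.Im z|.
Proof.
case: z => a b /=; rewrite -[leRHS]ger0_norm ?addr_ge0// -sqrtr_sqr ler_wsqrtr//.
by rewrite sqrrD !real_normK ?num_real// lerD2r lerDl mulrn_wge0// mulr_ge0.
Qed.

Lemma normc_distB_le z w : `|normc z - normc w| <= normc (z - w).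
Proof.
rewrite ler_norml lerNl opprB; apply/andP; split.
  rewrite lerBlDr normc_distC; apply: le_trans (normcD_le _ _).
  by rewrite subrK.
by rewrite lerBlDr; apply: le_trans (normcD_le _ _); rewrite subrK.
Qed.

End complex_modulus.

Section complex_measurability.
Context d (T : measurableType d) (R : realType).
Implicit Types (f : T -> R[i]) (h : R[i] -> R) (K : R).

(* [h (f x) < a] as soon as [h z + K * dist (f x) z < a] for some [z] with
   rational coordinates. *)
Lemma measurable_lipschitz_comp h K f : cmeasurable f ->
  (forall z w, `|h z - h w| <=
     K * (`|complex.Re z - complex.Re w| + `|complex.Im z - complex.Im w|)) ->
  measurable_fun setT (h \o f).
Proof.
move=> [mfR mfI] hK; have K0 : 0 <= K.
  by have := hK 1 0; rewrite /= !subr0 normr1 normr0 addr0 mulr1; apply: le_trans.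
pose F (a b : rat) x := h (ratr a +i* ratr b)%C +
  K * (`|complex.Re (f x) - ratr a| + `|complex.Im (f x) - ratr b|).
have mF a b : measurable_fun setT (F a b).
  apply: measurable_funD => //; apply: measurable_funM => //.
  by apply: measurable_funD; apply: measurableT_comp => //;
    apply: measurable_funB.
move=> mD; apply: (measurability _ (RGenInftyO.measurableE R)) => //.
move=> /= _ [_ [r ->] <-]; rewrite setTI.
rewrite [X in measurable X](_ : _ =
  \bigcup_(a : rat) \bigcup_(b : rat) (setT `&` F a b @^-1` `]-oo, r[%classic)).
  apply: bigcupT_measurable_rat => a; apply: bigcupT_measurable_rat => b.
  by apply: mF => //; exact: measurable_itv.
apply/seteqP; split => x /=; last first.
  move=> [a _ [b _ [_]]] /=; rewrite !in_itv/=; apply: le_lt_trans.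
  rewrite /F -lerBlDl; apply: le_trans (ler_norm _) _.
  exact: (hK (f x) (ratr a +i* ratr b)%C).
(* Each rational coordinate is within [e], so the distance [D] below is at most 2e. Moving from
   [f x] to the rational point costs K D twice, once in [h] and once in [F], hence at most 4Ke,
   which is less than r - h (f x). The [K + 1] covers K = 0. *)
rewrite in_itv/= => hr; pose e := (r - h (f x)) / (K + 1) / 4.
have K1 : 0 < K + 1 by rewrite ltr_wpDl.
have e0 : 0 < e by rewrite !divr_gt0// subr_gt0.
have [a] := @rat_in_itvoo R (complex.Re (f x)) (complex.Re (f x) + e)
  ltac:(by rewrite ltrDl).
rewrite in_itv/= => /andP[a1 a2].
have [b] := @rat_in_itvoo R (complex.Im (f x)) (complex.Im (f x) + e)
  ltac:(by rewrite ltrDl).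
rewrite in_itv/= => /andP[b1 b2].
exists a => //; exists b => //; split => //=; rewrite in_itv/=.
have := hK (f x) (ratr a +i* ratr b)%C; rewrite /F /=.
set D := (X in K * X) => hD.
have De : D <= e + e.
  by rewrite /D !ler0_norm ?subr_le0 ?(ltW a1) ?(ltW b1)// lerD// opprB lerBlDl ltW.
have {hD}hl : h (ratr a +i* ratr b)%C - h (f x) <= K * D.
  by apply: le_trans hD; rewrite distrC ler_norm.
have h2 : (K + 1) * (4 * e) = r - h (f x).
  by rewrite /e; field; rewrite gt_eqF.
have KD : K * D <= K * (e + e) by rewrite ler_wpM2l.
nra.
Qed.

Lemma measurable_normc f : cmeasurable f -> measurable_fun setT (fun x => normc (f x)).
Proof.
move=> mf; apply: (@measurable_lipschitz_comp (fun z => normc z) 1) => // z w.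
by rewrite mul1r (le_trans (normc_distB_le _ _))// -ReB -ImB normc_le_ReIm.
Qed.

Lemma cmeasurable_lipschitz_comp (g : R[i] -> R[i]) K f : 0 <= K ->
  lipschitz_bounds g K -> cmeasurable f -> cmeasurable (g \o f).
Proof.
move=> K0 gK mf.
have le1 z w : K * normc (z - w) <=
    K * (`|complex.Re z - complex.Re w| + `|complex.Im z - complex.Im w|).
  by rewrite ler_wpM2l// -ReB -ImB normc_le_ReIm.
split.
- apply: (@measurable_lipschitz_comp (fun z => complex.Re (g z)) K) => // z w.
  rewrite -ReB (le_trans (Re_le_normc _))//; exact: le_trans (gK _ _) (le1 _ _).
- apply: (@measurable_lipschitz_comp (fun z => complex.Im (g z)) K) => // z w.
  rewrite -ImB (le_trans (Im_le_normc _))//; exact: le_trans (gK _ _) (le1 _ _).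
Qed.

Lemma cmeasurable_cst (c : R[i]) : cmeasurable (fun _ : T => c).
Proof. by split. Qed.

Lemma cmeasurableB f1 f2 : cmeasurable f1 -> cmeasurable f2 ->
  cmeasurable (fun x => f1 x - f2 x).
Proof.
move=> [R1 I1] [R2 I2]; split.
  by under eq_fun do rewrite ReB; exact: measurable_funB.
by under eq_fun do rewrite ImB; exact: measurable_funB.
Qed.

Lemma cmeasurable_sum (I : eqType) (r : seq I) (F : I -> T -> R[i]) :
  (forall i, i \in r -> cmeasurable (F i)) ->
  cmeasurable (fun x => \sum_(i <- r) F i x).
Proof.
elim: r => [_|i r ih mF].
  by under eq_fun do rewrite big_nil; exact: cmeasurable_cst.
under eq_fun do rewrite big_cons.
(* The sum becomes an iterated difference, so that [cmeasurableB] applies. *)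
under eq_fun do rewrite -[F i _ + _]opprK opprD.
have mr : cmeasurable (fun x => \sum_(j <- r) F j x).
  by apply: ih => j jr; apply: mF; rewrite inE jr orbT.
have := cmeasurableB (cmeasurableB (cmeasurable_cst 0) (mF i (mem_head _ _))) mr.
move=> /(cmeasurableB (cmeasurable_cst 0)).
by under eq_fun do rewrite !sub0r.
Qed.

Lemma cmeasurable_simple (Q : set T) (c : R[i]) (a : T -> R[i]) :
  measurable Q -> (forall x, Q x -> a x = c) -> (forall x, ~ Q x -> a x = 0) ->
  cmeasurable a.
Proof.
move=> mQ aQ a0; have ac (h : R[i] -> R) : h 0 = 0 ->
    (fun x => h (a x)) = (fun x => h c * \1_Q x).
  move=> h0; apply/funext => x; rewrite indicE.
  have [xQ|xQ] := boolP (x \in Q).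
    by rewrite aQ ?mulr1//; rewrite inE in xQ.
  by rewrite a0 ?h0 ?mulr0//; move: xQ; rewrite notin_setE.
split; rewrite ac//; apply: measurable_funM => //; exact: measurable_indic.
Qed.

End complex_measurability.

(** * Mean oscillation *)

Section power_integrals.
Context d (T : measurableType d) (R : realType).
Variable mu : {finite_measure set T -> \bar R}.
Implicit Types (f g : T -> R[i]) (p : R) (D Q : set T).

(** The p-th root is left out to keep additivity in [D]: energies can then be summed over cells with
    weights. *)
Definition pow_integral p f D : \bar R :=
  (\int[mu]_(x in D) ((normc (f x)) `^ p)%:E)%E.

Lemma pow_integral_ge0 p f D : (0 <= pow_integral p f D)%E.
Proof. by apply: integral_ge0 => x _; rewrite lee_fin powR_ge0. Qed.

Lemma measurable_pow_normc p f D : cmeasurable f ->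
  measurable_fun D (fun x => ((normc (f x)) `^ p)%:E).
Proof.
move=> mf; apply/measurable_EFinP; apply: measurable_funTS.
exact: measurableT_comp (measurable_powR p) (measurable_normc mf).
Qed.

Lemma cLnormE p f : cLnorm mu p f = (pow_integral p f setT `^ p^-1)%E.
Proof.
rewrite /cLnorm unlock; congr (_ `^ _)%E; apply: eq_integral => x _.
by rewrite abse_EFin ger0_norm ?normc_ge0.
Qed.

Lemma pow_integral_le p K f g D : 0 <= p -> 0 <= K -> measurable D ->
  cmeasurable f -> cmeasurable g ->
  (forall x, D x -> normc (f x) <= K * normc (g x)) ->
  (pow_integral p f D <= (K `^ p)%:E * pow_integral p g D)%E.
Proof.
move=> p0 K0 mD mf mg fg.
rewrite -ge0_integralZl_EFin ?powR_ge0//; last first.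
- exact: measurable_pow_normc.
- by move=> x _; rewrite lee_fin powR_ge0.
apply: ge0_le_integral => //.
- by move=> x _; rewrite lee_fin powR_ge0.
- exact: measurable_pow_normc.
- by apply: measurable_funeM; exact: measurable_pow_normc.
- move=> x Dx; rewrite -EFinM lee_fin -powRM ?normc_ge0//.
  by rewrite ge0_ler_powR ?nnegrE ?mulr_ge0 ?normc_ge0//; exact: fg.
Qed.

Lemma powRD_le p (a b : R) : 0 <= p -> 0 <= a -> 0 <= b ->
  (a + b) `^ p <= 2 `^ p * (a `^ p + b `^ p).
Proof.
move=> p0 a0 b0; have := @poweRD_le R p a%:E b%:E p0.
by rewrite !lee_fin; exact.
Qed.

Lemma pow_integralB_le p f g h D : 0 <= p -> measurable D ->
  cmeasurable f -> cmeasurable g -> cmeasurable h ->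
  (pow_integral p (fun x => f x - g x)%R D <=
    (2 `^ p)%:E * (pow_integral p (fun x => f x - h x)%R D +
                   pow_integral p (fun x => h x - g x)%R D))%E.
Proof.
move=> p0 mD mf mg mh.
have m1 := @measurable_pow_normc p _ D (cmeasurableB mf mh).
have m2 := @measurable_pow_normc p _ D (cmeasurableB mh mg).
have e0 (u : T -> R[i]) x : D x -> (0 <= ((normc (u x)) `^ p)%:E)%E.
  by move=> _; rewrite lee_fin powR_ge0.
rewrite -ge0_integralD//; last 2 first.
- exact: (e0 (fun x => f x - h x)).
- exact: (e0 (fun x => h x - g x)).
rewrite -ge0_integralZl_EFin ?powR_ge0//; last 2 first.
- by move=> x Dx; rewrite lee_fin addr_ge0 ?powR_ge0.
- exact: emeasurable_funD.
apply: ge0_le_integral => //.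
- exact: (e0 (fun x => f x - g x)).
- exact: (@measurable_pow_normc p _ D (cmeasurableB mf mg)).
- by apply: measurable_funeM; exact: emeasurable_funD.
move=> x Dx; rewrite -EFinD -EFinM lee_fin.
apply: le_trans (powRD_le p0 (normc_ge0 _) (normc_ge0 _)).
by rewrite ge0_ler_powR ?nnegrE ?addr_ge0 ?normc_ge0// normc_distD_le.
Qed.

Lemma pow_integral_cst p (c : R[i]) D : measurable D ->
  pow_integral p (fun=> c) D = ((normc c `^ p)%:E * mu D)%E.
Proof. by move=> mD; rewrite /pow_integral integral_cst. Qed.

Lemma osc_ge0 p f Q : (0 <= osc mu p f Q)%E.
Proof. by apply/ereal_infP => _ [c _ <-]; exact: poweR_ge0. Qed.

Lemma osc_le p f Q c :
  (osc mu p f Q <= pow_integral p (fun x => f x - c)%R Q `^ p^-1)%E.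
Proof. by apply: ereal_inf_lbound; exists c. Qed.

Lemma osc_poweR_le p f Q c : 0 < p ->
  (osc mu p f Q `^ p <= pow_integral p (fun x => f x - c)%R Q)%E.
Proof.
move=> p0; apply: le_trans (le_poweR (ltW p0) (osc_ge0 _ _ _) (osc_le p f Q c)) _.
by rewrite poweRVK// pow_integral_ge0.
Qed.

Lemma osc_lipschitz p K (g : R[i] -> R[i]) f Q : 0 < p -> 0 <= K ->
  lipschitz_bounds g K -> cmeasurable f -> measurable Q ->
  (osc mu p (g \o f) Q <= K%:E * osc mu p f Q)%E.
Proof.
move=> p0 K0 gK mf mQ; have mgf := cmeasurable_lipschitz_comp K0 gK mf.
have h c : (osc mu p (g \o f) Q <=
    K%:E * pow_integral p (fun x => f x - c)%R Q `^ p^-1)%E.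
  apply: le_trans (osc_le p _ Q (g c)) _.
  have -> : K%:E = ((K `^ p)%:E `^ p^-1)%E.
    by rewrite poweR_EFin -powRrM mulfV ?gt_eqF// powRr1.
  rewrite -poweRM ?lee_fin ?powR_ge0 ?pow_integral_ge0//.
  apply: le_poweR; rewrite ?pow_integral_ge0 ?invr_ge0 ?(ltW p0)//.
  apply: pow_integral_le => //; first exact: ltW.
  - exact: cmeasurableB (cmeasurable_cst _ _).
  - exact: cmeasurableB (cmeasurable_cst _ _).
  - by move=> x _; exact: gK.
(* Passing to the infimum over [c] requires dividing by [K]. For K = 0 any constant will do, since 0
   times anything is 0, even +oo. *)
move: K0; rewrite le_eqVlt => /predU1P[K0|K0].
  by have := h 0; rewrite -K0 !mul0e.
rewrite -lee_pdivrMl//; apply/ereal_infP => _ [c _ <-].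
by rewrite lee_pdivrMl//; exact: h.
Qed.

(* [r] is the supremum of the lower bounds [u e - M * e]. *)
Lemma net_limit M (u : R -> R) :
  (forall e1 e2, 0 < e1 -> 0 < e2 -> `|u e1 - u e2| <= M * (e1 + e2)) ->
  exists r, forall e, 0 < e -> `|u e - r| <= M * e.
Proof.
move=> hu; pose E := [set y | exists2 e, 0 < e & y = u e - M * e].
have ub e : 0 < e -> ubound E (u e + M * e).
  move=> e0 _ [e' e'0 ->]; have := hu _ _ e'0 e0; rewrite mulrDr => /ler_normlP[_].
  by move=> h; lra.
exists (sup E) => e e0; rewrite ler_distlC; apply/andP; split.
  rewrite lerBlDr -lerBlDr.
  have : u e - M * e <= sup E; last by lra.
  apply: ub_le_sup; last by exists e.
  by exists (u 1 + M * 1); exact: ub.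
have : sup E <= u e + M * e; last by lra.
by apply: ge_sup; [exists (u 1 - M * 1), 1|exact: ub].
Qed.

(* A constant that is optimal up to a factor 2 exists trivially unless the
   oscillation vanishes; in that case the infimum is attained, because
   near-optimal constants form a Cauchy net. *)
Lemma osc_near_optimal p f Q : 0 < p -> cmeasurable f -> measurable Q ->
  (0 < mu Q)%E -> exists c,
  (pow_integral p (fun x => f x - c)%R Q <= (2 `^ p)%:E * osc mu p f Q `^ p)%E.
Proof.
move=> p0 mf mQ Q0; have p0' := ltW p0.
have [zy|zy] := eqVneq (osc mu p f Q) +oo%E.
  by exists 0; rewrite zy poweRyr ?gt_eqF// gt0_muley ?leey// lte_fin powR_gt0.
have := osc_ge0 p f Q; rewrite le_eqVlt => /predU1P[z0|z0]; last first.
  have : (osc mu p f Q < 2%:E * osc mu p f Q)%E.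
    have : osc mu p f Q \is a fin_num by rewrite ge0_fin_numE ?(ltW z0)// ltey.
    move: z0; case: (osc mu p f Q) => // r; rewrite lte_fin => r0 _.
    by rewrite -EFinM lte_fin; lra.
  move=> /ereal_inf_lt[_ [c _ <-] /ltW h]; exists c.
  rewrite -poweR_EFin -poweRM ?lee_fin// ?(ltW z0)//.
  by apply: poweR_le_pow => //; exact: pow_integral_ge0.
(* The condition 0 < e sits under the existential so that [choice] yields a function on all of
   [R]. *)
have {zy} : forall e, exists c, 0 < e ->
    (pow_integral p (fun x => f x - c)%R Q <= (e `^ p)%:E)%E.
  move=> e; have [e0|e0] := ltP 0 e; last by exists 0.
  have : (osc mu p f Q < e%:E)%E by rewrite -z0 lte_fin.
  move=> /ereal_inf_lt[_ [c _ <-] /ltW h]; exists c => _.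
  by rewrite -poweR_EFin; apply: poweR_le_pow => //; exact: pow_integral_ge0.
move=> /choice[c hc].
have muQ : mu Q = (fine (mu Q))%:E by rewrite fineK// fin_num_measure.
set m := fine (mu Q) in muQ; have m0 : 0 < m by move: Q0; rewrite muQ lte_fin.
(* Comparing two near-optimal constants through [f] gives |c e1 - c e2|^p m <= 2^p (e1^p + e2^p) <=
   2^p 2 (e1 + e2)^p, which dictates [M]. *)
pose M := (2 `^ p * 2 / m) `^ p^-1.
have M0 : 0 <= M by exact: powR_ge0.
have mB c' := cmeasurableB mf (cmeasurable_cst T c').
have cM e1 e2 : 0 < e1 -> 0 < e2 -> normc (c e1 - c e2) <= M * (e1 + e2).
  move=> e10 e20.
  have e12 : 0 < e1 + e2 by rewrite addr_gt0.
  have h1 : (pow_integral p (fun x => c e1 - f x)%R Q <= (e1 `^ p)%:E)%E.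
    rewrite /pow_integral; under eq_integral do rewrite normc_distC.
    exact: hc.
  have := pow_integralB_le p0' mQ (cmeasurable_cst T (c e1))
    (cmeasurable_cst T (c e2)) mf.
  move=> /le_trans => /(_ ((2 `^ p)%:E * (e1 `^ p + e2 `^ p)%:E)%E).
  rewrite lee_wpmul2l ?lee_fin ?powR_ge0// ?EFinD ?leeD ?hc// => /(_ isT).
  rewrite pow_integral_cst// muQ -EFinD -!EFinM lee_fin => h2.
  have h3 : normc (c e1 - c e2) `^ p <= (M * (e1 + e2)) `^ p.
    rewrite powRM// ?(ltW e12)// /M -powRrM mulVf ?gt_eqF// powRr1; last first.
      by rewrite divr_ge0 ?mulr_ge0 ?powR_ge0// ltW.
    rewrite mulrAC ler_pdivlMr// (le_trans h2)// -mulrA ler_wpM2l ?powR_ge0//.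
    rewrite mulr_natl mulr2n lerD// ge0_ler_powR ?nnegrE ?(ltW e12) ?ltW//
      ?ltrDl ?ltrDr//.
  rewrite leNgt; apply/negP => /(gt0_ltr_powR p0).
  by rewrite !nnegrE normc_ge0 mulr_ge0 ?(ltW e12)// ltNge h3 => /(_ isT isT).
have [a ha] : exists a, forall e, 0 < e -> `|complex.Re (c e) - a| <= M * e.
  apply: net_limit => e1 e2 e10 e20.
  by rewrite -ReB (le_trans (Re_le_normc _))// cM.
have [b hb] : exists b, forall e, 0 < e -> `|complex.Im (c e) - b| <= M * e.
  apply: net_limit => e1 e2 e10 e20.
  by rewrite -ImB (le_trans (Im_le_normc _))// cM.
exists (a +i* b)%C; rewrite -z0 poweR0r ?gt_eqF// mule0.
set L := pow_integral _ _ _.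
have L0 : (0 <= L)%E by exact: pow_integral_ge0.
(* The two terms come from f - c e, of energy at most e^p, and from the constant c e - (a + ib), of
   modulus at most 2Me because each coordinate contributes Me. *)
pose C := 2 `^ p * (1 + (2 * M) `^ p * m).
have C0 : 0 < C.
  by rewrite mulr_gt0 ?powR_gt0// ltr_wpDr// mulr_ge0 ?powR_ge0// ltW.
have hL e : 0 < e -> (L <= (C * e `^ p)%:E)%E.
  move=> e0; apply: le_trans (pow_integralB_le p0' mQ mf
    (cmeasurable_cst T (a +i* b)%C) (cmeasurable_cst T (c e))) _.
  rewrite /C -mulrA EFinM; apply: lee_wpmul2l; first by rewrite lee_fin powR_ge0.
  rewrite mulrDl mul1r EFinD; apply: leeD; first exact: hc.
  rewrite pow_integral_cst// muQ -EFinM lee_fin mulrAC ler_wpM2r ?(ltW m0)//.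
  rewrite -powRM ?mulr_ge0 ?(ltW e0)//.
  rewrite ge0_ler_powR ?nnegrE ?normc_ge0 ?mulr_ge0 ?(ltW e0)//.
  apply: le_trans (normc_le_ReIm _) _; rewrite ReB ImB/=.
  by have := ha e e0; have := hb e e0; lra.
suff : (L `^ p^-1 <= 0)%E.
  move=> h; suff -> : L = 0%E by [].
  apply: (@poweR_eq0_eq0 _ _ p^-1) => //.
  by apply/eqP; rewrite eq_le h poweR_ge0.
apply/lee_addgt0Pr => e e0; rewrite add0e.
have Cp : 0 < C `^ p^-1 by rewrite powR_gt0.
have e'0 : 0 < e / C `^ p^-1 by rewrite divr_gt0.
apply: le_trans (le_poweR _ L0 (hL _ e'0)) _; first by rewrite invr_ge0.
rewrite poweR_EFin lee_fin powRM ?powR_ge0 ?(ltW C0)// -powRrM mulfV ?gt_eqF//.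
by rewrite powRr1 ?(ltW e'0)// mulrCA mulfV ?gt_eqF// mulr1.
Qed.

End power_integrals.

(** * Layers over a grid *)

Section grid_theory.
Context d (T : measurableType d) (R : realType).
Variables (mu : {finite_measure set T -> \bar R}) (P : nat -> set (set T)).
Variables (l1 l2 : R).
Hypotheses (l1_gt0 : 0 < l1) (l12 : l1 < l2) (l2_lt1 : l2 < 1).
Hypothesis gridP : is_grid mu l1 l2 P.

Implicit Types Q W : set T.
Local Notation m Q := (fine (mu Q)).

Let l2_gt0 : 0 < l2. Proof. exact: lt_trans l12. Qed.

Lemma measure_fine Q : measurable Q -> mu Q = (m Q)%:E.
Proof. by move=> mQ; rewrite fineK// fin_num_measure. Qed.

Lemma grid_fine_gt0 k Q : P k Q -> 0 < m Q.
Proof.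
move=> PQ; have mQ := grid_measurable gridP PQ.
by rewrite -lte_fin -(measure_fine mQ); have := grid_gt0 gridP PQ.
Qed.

Lemma mem_grid k Q : (Q \in fset_set (P k)) = (Q \in P k).
Proof. by rewrite in_fset_set//; exact: grid_finite gridP k. Qed.

Lemma grid_sumE (V : Type) (idx : V) (op : Monoid.com_law idx) k (F : set T -> V) :
  \big[op/idx]_(Q \in P k) F Q = \big[op/idx]_(Q <- fset_set (P k)) F Q.
Proof. by rewrite fsbig_finite//; exact: grid_finite gridP k. Qed.

Lemma grid_esumE k (F : set T -> \bar R) :
  (\sum_(Q \in P k) F Q = \sum_(Q <- fset_set (P k)) F Q)%E.
Proof. exact: grid_sumE. Qed.

Lemma grid_lee_sum k (F G : set T -> \bar R) :
  (forall Q, P k Q -> (F Q <= G Q)%E) ->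
  (\sum_(Q \in P k) F Q <= \sum_(Q \in P k) G Q)%E.
Proof.
move=> FG; rewrite (grid_esumE k F) (grid_esumE k G) big_seq [leRHS]big_seq.
by apply: lee_sum => Q; rewrite mem_grid inE; exact: FG.
Qed.

Lemma grid_sum_distrr k x (F : set T -> \bar R) : (forall Q, (0 <= F Q)%E) ->
  (x * (\sum_(Q \in P k) F Q) = \sum_(Q \in P k) x * F Q)%E.
Proof.
move=> F0; rewrite (grid_esumE k F) (grid_esumE k (fun Q => x * F Q)%E).
by rewrite ge0_sume_distrr.
Qed.

Lemma grid_same k Q W x : P k Q -> P k W -> Q x -> W x -> Q = W.
Proof.
by move=> PQ PW Qx Wx; apply: (grid_disjoint gridP PQ PW); exists x.
Qed.

Lemma grid_sum_single (V : Type) (idx : V) (op : Monoid.com_law idx) k Q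
    (F : set T -> V) : P k Q ->
  (forall W, P k W -> W <> Q -> F W = idx) -> \big[op/idx]_(W \in P k) F W = F Q.
Proof.
move=> PQ F0; rewrite (fsbigD1 Q)//; last exact: grid_finite gridP k.
by rewrite fsbig1 ?Monoid.mulm1// => W [PW /= WQ]; exact: F0.
Qed.

(** Each generation multiplies the measure by at most [l2]; the decay factors in the energy and
    convergence estimates come from here. *)
Lemma grid_ancestor k n Q : P (k + n)%N Q ->
  exists W, [/\ P k W, Q `<=` W & m Q <= l2 ^+ n * m W].
Proof.
elim: n Q => [|n ih] Q; first by rewrite addn0 => PQ; exists Q; rewrite expr0 mul1r; split.
rewrite addnS => PQ; have [W' PW' QW'] := grid_nested gridP PQ.
have [W [PW W'W h]] := ih _ PW'; exists W; split => //.
  exact: subset_trans W'W.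
have /andP[_] := grid_ratio gridP PQ PW' QW'.
rewrite ler_pdivrMr ?(grid_fine_gt0 PW')// => /le_trans; apply.
by rewrite exprS -mulrA ler_pM2l.
Qed.

(** * Energy of layers and of tails of a representation *)

Section layers.
Variables (s p : R) (c : nat -> set T -> R[i]) (a : nat -> set T -> T -> R[i]).
Hypotheses (s_gt0 : 0 < s) (p_gt0 : 0 < p).
Hypothesis atoms : forall k Q, P k Q -> souza_atom mu s p Q (a k Q).

Let sp_ge0 : 0 <= s * p. Proof. by rewrite mulr_ge0// ltW. Qed.

Lemma layer_in k Q x : P k Q -> Q x -> layer P c a k x = c k Q * a k Q x.
Proof.
move=> PQ Qx; rewrite /layer (@grid_sum_single _ _ _ k Q _ PQ)// => W PW WQ.
have [_ a0 _] := atoms PW; rewrite a0 ?mulr0// => Wx.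
exact/WQ/(grid_same PW PQ Wx).
Qed.

Lemma layer_out k x : (forall Q, P k Q -> ~ Q x) -> layer P c a k x = 0.
Proof.
move=> nx; rewrite /layer fsbig1// => W PW.
by have [_ a0 _] := atoms PW; rewrite a0 ?mulr0//; exact: nx.
Qed.

Lemma layer_constant k n W x y : P (k + n)%N W -> W x -> W y ->
  layer P c a k x = layer P c a k y.
Proof.
move=> PW Wx Wy; have [Q [PQ WQ _]] := grid_ancestor PW.
rewrite !(layer_in PQ)//; [|exact: WQ|exact: WQ].
by have [[e aE] _ _] := atoms PQ; rewrite !aE//; exact: WQ.
Qed.

Lemma cmeasurable_layer k : cmeasurable (layer P c a k).
Proof.
rewrite /layer; under eq_fun do rewrite grid_sumE.
apply: cmeasurable_sum => Q; rewrite mem_grid inE => PQ.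
have [[e aE] a0 _] := atoms PQ.
apply: (cmeasurable_simple (grid_measurable gridP PQ) (c := c k Q * e)) => x Qx.
  by rewrite aE.
by rewrite a0 ?mulr0.
Qed.

Lemma cmeasurable_layers u v : cmeasurable (fun x => \sum_(u <= k < v) layer P c a k x).
Proof. by apply: cmeasurable_sum => k _; exact: cmeasurable_layer. Qed.

(** By disjointness at most one cell contains [x], so the p-th power passes through the sum without
    loss; the atom bound contributes |Q|^((s - 1/p)p). *)
Lemma normc_layer_le k x : normc (layer P c a k x) `^ p <=
  \sum_(Q <- fset_set (P k)) (normc (c k Q) `^ p * m Q `^ (s * p - 1)) * \1_Q x.
Proof.
have t0 Q : 0 <= normc (c k Q) `^ p * m Q `^ (s * p - 1) * \1_Q x.
  by rewrite !mulr_ge0 ?powR_ge0// indicE.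
have [[Q PQ Qx]|nx] := pselect (exists2 Q, P k Q & Q x); last first.
  rewrite layer_out => [|Q PQ Qx]; last by apply: nx; exists Q.
  by rewrite ComplexField.Normc.normc0 powR0 ?gt_eqF// sumr_ge0.
rewrite (layer_in PQ Qx) (big_fsetD1 Q)/= ?mem_grid ?inE//.
apply: ler_wpDr; first by rewrite sumr_ge0.
rewrite indicE mem_set// mulr1 ComplexField.Normc.normcM powRM ?normc_ge0//.
rewrite ler_wpM2l ?powR_ge0//.
have [_ _ ab] := atoms PQ.
have -> : s * p - 1 = (s - p^-1) * p by rewrite mulrBl mulVf ?gt_eqF.
by rewrite powRrM ge0_ler_powR ?nnegrE ?normc_ge0 ?powR_ge0// ltW.
Qed.

(** [besov_cost] is, by conversion, the mixed norm of this sequence. *)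
Definition coef_mass k : \bar R := (\sum_(Q \in P k) (normc (c k Q) `^ p)%:E)%E.

Lemma coef_mass_ge0 k : (0 <= coef_mass k)%E.
Proof. by rewrite /coef_mass grid_esumE sume_ge0// => Q _; rewrite lee_fin powR_ge0. Qed.

Lemma pow_integral_layer_le k W : measurable W ->
  (pow_integral mu p (layer P c a k) W <= \sum_(Q <- fset_set (P k))
     (normc (c k Q) `^ p * m Q `^ (s * p - 1))%:E * mu (Q `&` W))%E.
Proof.
move=> mW; set r := fset_set (P k).
(* The default 0 makes [F Q] measurable for every set [Q], as the exchange of sum and integral
   demands of every index. *)
pose F (Q : set T) (x : T) : \bar R :=
  if Q \in r then ((normc (c k Q) `^ p * m Q `^ (s * p - 1)) * \1_Q x)%:E else 0%E.
have mr Q : Q \in r -> measurable Q.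
  by rewrite mem_grid inE => PQ; exact: (grid_measurable gridP PQ).
have mF Q : measurable_fun W (F Q).
  rewrite /F; have := mr Q; case: (Q \in r) => [/(_ isT) mQ|_] //.
  apply/measurable_EFinP.
  by apply: measurable_funM => //; exact: measurable_indic.
have F0 Q x : W x -> (0 <= F Q x)%E.
  move=> _; rewrite /F; case: ifPn => // _.
  by rewrite lee_fin !mulr_ge0 ?powR_ge0// indicE.
have -> : (\sum_(Q <- r) (normc (c k Q) `^ p * m Q `^ (s * p - 1))%:E *
    mu (Q `&` W) = \int[mu]_(x in W) \sum_(Q <- r) F Q x)%E.
  rewrite ge0_integral_sum//; rewrite big_seq [RHS]big_seq; apply: eq_bigr => Q Qr.
  rewrite /F Qr; under eq_integral do rewrite EFinM.
  rewrite ge0_integralZl_EFin//; last 2 first.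
  - by apply/measurable_EFinP; apply: measurable_indic; exact: mr.
  - by rewrite mulr_ge0 ?powR_ge0.
  by rewrite integral_indic//; exact: mr.
apply: ge0_le_integral => //.
- by move=> x _; rewrite lee_fin powR_ge0.
- by apply: measurable_pow_normc; exact: cmeasurable_layer.
- exact: emeasurable_sum.
move=> x _; apply: (@le_trans _ _ (\sum_(Q <- r)
    (normc (c k Q) `^ p * m Q `^ (s * p - 1)) * \1_Q x)%:E).
  by rewrite lee_fin; exact: normc_layer_le.
rewrite -sumEFin big_seq [leRHS]big_seq; apply: lee_sum => Q Qr.
by rewrite /F Qr.
Qed.

(** A cell Q of level k + n meets only its ancestor W among the cells of level k. Its contribution
    is |c Q|^p |Q|^(sp-1) |Q| |W|^(-sp) = |c Q|^p (|Q|/|W|)^(sp), and |Q|/|W| <= l2^n. *)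
Lemma layer_energy_le k n :
  (\sum_(W \in P k) (m W `^ (- (s * p)))%:E *
     pow_integral mu p (layer P c a (k + n)) W <=
   ((l2 `^ (s * p)) ^+ n)%:E * coef_mass (k + n))%E.
Proof.
rewrite /coef_mass !grid_esumE; set r := fset_set (P (k + n)%N).
pose K Q := normc (c (k + n)%N Q) `^ p * m Q `^ (s * p - 1).
have K0 Q : 0 <= K Q by rewrite mulr_ge0 ?powR_ge0.
apply: (@le_trans _ _ (\sum_(W <- fset_set (P k)) \sum_(Q <- r)
    (K Q * m W `^ (- (s * p)))%:E * mu (Q `&` W))%E).
  rewrite big_seq [leRHS]big_seq; apply: lee_sum => W; rewrite mem_grid inE => PW.
  apply: (@le_trans _ _ ((m W `^ (- (s * p)))%:E *
    \sum_(Q <- r) (K Q)%:E * mu (Q `&` W))%E).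
    apply: lee_wpmul2l; first by rewrite lee_fin powR_ge0.
    by apply: pow_integral_layer_le; exact: (grid_measurable gridP PW).
  rewrite ge0_sume_distrr; last by move=> Q _; rewrite mule_ge0 ?lee_fin.
  by apply: lee_sum => Q _; rewrite muleA -EFinM mulrC.
rewrite exchange_big/= ge0_sume_distrr; last by move=> Q _; rewrite lee_fin powR_ge0.
rewrite big_seq [leRHS]big_seq; apply: lee_sum => Q; rewrite mem_grid inE => PQ.
have [W [PW QW h]] := grid_ancestor PQ.
rewrite -(grid_esumE k (fun W => (K Q * m W `^ (- (s * p)))%:E * mu (Q `&` W))%E).
rewrite (@grid_sum_single _ _ _ k W _ PW)//; last first.
  move=> W' PW' W'W; have -> : Q `&` W' = set0.
    apply/seteqP; split => // x [Qx W'x]; apply: W'W.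
    exact: grid_same PW' PW W'x (QW _ Qx).
  by rewrite measure0 mule0.
rewrite setIidl// (measure_fine (grid_measurable gridP PQ)).
have mQ := grid_fine_gt0 PQ; have mW := grid_fine_gt0 PW.
rewrite -!EFinM lee_fin /K -[_ * m W `^ _ * _]mulrA [m W `^ _ * _]mulrC mulrA.
have -> : normc (c (k + n)%N Q) `^ p * m Q `^ (s * p - 1) * m Q =
    normc (c (k + n)%N Q) `^ p * m Q `^ (s * p).
  rewrite -mulrA; congr (_ * _); rewrite -{2}[m Q]powRr1 ?ltW// -powRD ?subrK//.
  by rewrite (gt_eqF mQ) implybT.
rewrite powRN -mulrA mulrC; apply: ler_wpM2r; rewrite ?powR_ge0//.
rewrite ler_pdivrMr ?powR_gt0// -powR_exprn ?(ltW l2_gt0)//.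
rewrite -powRM ?exprn_ge0 ?(ltW l2_gt0) ?(ltW mW)//.
apply: (ge0_ler_powR sp_ge0) => //; rewrite nnegrE ?(ltW mQ)//.
by rewrite mulr_ge0 ?exprn_ge0 ?(ltW l2_gt0) ?(ltW mW).
Qed.

(* The growing factor [(z^-1 `^ p) ^+ n] is later absorbed, for [z = l2 `^ s], by
   the decay of the weighted energy of the layers in [layer_energy_le]. *)
Lemma pow_integral_layers_le (z C w : R) D u N : 0 < z -> 0 <= C -> 0 <= w ->
  (forall x : nat -> \bar R, (forall n, 0 <= x n)%E ->
    ((\sum_(n <oo) (z ^+ n)%:E * x n) `^ p <=
      C%:E * \sum_(n <oo) (w ^+ n)%:E * x n `^ p)%E) ->
  measurable D ->
  (pow_integral mu p (fun x => \sum_(0 <= k < u + N) layer P c a k x -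
                               \sum_(0 <= k < u) layer P c a k x)%R D <=
   C%:E * \sum_(n <oo) (w ^+ n * (z^-1 `^ p) ^+ n)%:E *
                       pow_integral mu p (layer P c a (u + n)) D)%E.
Proof.
move=> z0 C0 w0 hgeo mD.
pose y n x := normc (layer P c a (u + n) x).
pose v n := w ^+ n * (z^-1 `^ p) ^+ n.
have v0 n : 0 <= v n by rewrite mulr_ge0 ?exprn_ge0 ?powR_ge0.
have F0 n x : (0 <= (v n)%:E * (y n x `^ p)%:E)%E.
  by rewrite -EFinM lee_fin mulr_ge0 ?powR_ge0.
have mF n : measurable_fun D (fun x => (v n)%:E * (y n x `^ p)%:E)%E.
  by apply: measurable_funeM; apply: measurable_pow_normc; exact: cmeasurable_layer.
have -> : (\sum_(n <oo) (v n)%:E * pow_integral mu p (layer P c a (u + n)) D =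
    \int[mu]_(x in D) \sum_(n <oo) (v n)%:E * (y n x `^ p)%:E)%E.
  rewrite integral_nneseries//; apply: eq_eseriesr => n _.
  rewrite ge0_integralZl_EFin//.
  - by move=> x _; rewrite lee_fin powR_ge0.
  - by apply: measurable_pow_normc; exact: cmeasurable_layer.
have mS : measurable_fun D (fun x => \sum_(n <oo) (v n)%:E * (y n x `^ p)%:E)%E.
  exact: (@ge0_emeasurable_sum _ _ _ D (fun n x => (v n)%:E * (y n x `^ p)%:E)%E xpredT).
rewrite -ge0_integralZl_EFin//; last by move=> x _; exact: nneseries_ge0.
apply: ge0_le_integral => //.
- by move=> x _; rewrite lee_fin powR_ge0.
- by apply: measurable_pow_normc; apply: cmeasurableB; exact: cmeasurable_layers.
- exact: measurable_funeM.
move=> x _.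
have -> : \sum_(0 <= k < u + N) layer P c a k x - \sum_(0 <= k < u) layer P c a k x
    = \sum_(0 <= n < N) layer P c a (u + n) x.
  rewrite (big_cat_nat (n := u)) ?leq_addr//= [LHS]addrC addKr.
  rewrite -{1}[u]add0n big_addn addKn.
  by apply: eq_bigr => n _; rewrite addnC.
(* Dividing by z^n puts the sum into the form required by [hgeo]; this is where the growing factor
   z^(-pn) arises. *)
pose t n := ((z^-1) ^+ n * y n x)%:E.
have t0 n : (0 <= t n)%E.
  by rewrite lee_fin mulr_ge0 ?normc_ge0// exprn_ge0// invr_ge0 ltW.
have e n : ((z ^+ n)%:E * t n = (y n x)%:E)%E.
  by rewrite -EFinM mulrA -exprMn mulfV ?gt_eqF// expr1n mul1r.
have h1 : ((normc (\sum_(0 <= n < N) layer P c a (u + n) x))%:E <=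
    \sum_(n <oo) (z ^+ n)%:E * t n)%E.
  under eq_eseriesr do rewrite e.
  apply: (@le_trans _ _ (\sum_(0 <= n < N) (y n x)%:E)%E).
    by rewrite sumEFin lee_fin normc_sum_le.
  by apply: nneseries_lim_ge => n _; rewrite lee_fin normc_ge0.
rewrite -poweR_EFin; apply: le_trans (le_poweR (ltW p_gt0) _ h1) _.
  by rewrite lee_fin normc_ge0.
apply: le_trans (hgeo _ t0) _; apply: lee_wpmul2l => //.
apply: lee_nneseries => n _; first by rewrite mule_ge0 ?poweR_ge0// lee_fin exprn_ge0.
rewrite /t poweR_EFin powRM ?normc_ge0 ?exprn_ge0 ?invr_ge0 ?(ltW z0)//.
by rewrite powR_exprn ?invr_ge0 ?(ltW z0)// -!EFinM mulrA.
Qed.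

(** The series on the right does not depend on [N]. Hence [N] can later be taken so large that the
    other term is negligible, using nothing but convergence of the partial sums in L^p. *)
Lemma pow_integral_tail_le (z C w : R) f D u N :
  0 < z -> 0 <= C -> 0 <= w ->
  (forall x : nat -> \bar R, (forall n, 0 <= x n)%E ->
    ((\sum_(n <oo) (z ^+ n)%:E * x n) `^ p <=
      C%:E * \sum_(n <oo) (w ^+ n)%:E * x n `^ p)%E) ->
  measurable D -> cmeasurable f ->
  (pow_integral mu p (fun x => f x - \sum_(0 <= k < u) layer P c a k x)%R D <=
   (2 `^ p)%:E * (pow_integral mu p
       (fun x => f x - \sum_(0 <= k < u + N) layer P c a k x)%R D +
     C%:E * \sum_(n <oo) (w ^+ n * (z^-1 `^ p) ^+ n)%:E *
       pow_integral mu p (layer P c a (u + n)) D))%E.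
Proof.
move=> z0 C0 w0 hgeo mD mf.
apply: le_trans (pow_integralB_le mu (ltW p_gt0) mD mf (cmeasurable_layers 0 u)
  (cmeasurable_layers 0 (u + N))) _.
apply: lee_wpmul2l; first by rewrite lee_fin powR_ge0.
by apply: leeD => //; exact: pow_integral_layers_le.
Qed.

(** After interchanging the sums over cells and over layers, [layer_energy_le] provides
    l2^(sp(i+n)), which cancels the growth z^(-pn) since z = l2^s; the remaining l2^(spi) is at most
    1. The shift [i] is 0 for the L^p norm and 1 for the oscillation, where the layer of level k is
    subtracted too. *)
Lemma weighted_tail_le (C w : R) f k i :
  0 <= C -> 0 <= w ->
  (forall x : nat -> \bar R, (forall n, 0 <= x n)%E ->
    ((\sum_(n <oo) ((l2 `^ s) ^+ n)%:E * x n) `^ p <=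
      C%:E * \sum_(n <oo) (w ^+ n)%:E * x n `^ p)%E) ->
  cmeasurable f ->
  (forall e, 0 < e -> exists N, (pow_integral mu p
    (fun x => f x - \sum_(0 <= j < k + i + N) layer P c a j x)%R setT <= e%:E)%E) ->
  (\sum_(W \in P k) (m W `^ (- (s * p)))%:E *
     pow_integral mu p (fun x => f x - \sum_(0 <= j < k + i) layer P c a j x)%R W <=
   (2 `^ p * C)%:E * \sum_(n <oo) (w ^+ n)%:E * coef_mass (k + i + n))%E.
Proof.
move=> C0 w0 hgeo mf hN; set z := l2 `^ s.
have z0 : 0 < z by rewrite powR_gt0.
set r := fset_set (P k); pose W0 := \sum_(W <- r) m W `^ (- (s * p)).
have W0ge0 : 0 <= W0 by apply: sumr_ge0 => W _; exact: powR_ge0.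
have mr W : W \in r -> measurable W.
  by rewrite mem_grid inE => PW; exact: (grid_measurable gridP PW).
pose v n := w ^+ n * (z^-1 `^ p) ^+ n.
have v0 n : 0 <= v n by rewrite mulr_ge0 ?exprn_ge0 ?powR_ge0.
apply/lee_addgt0Pr => e e0.
(* The remainder is counted once per cell with its weight, giving the total 2^p W0 e' <= e; the
   [+ 1] keeps the denominator positive. *)
pose e' := e / (2 `^ p * (W0 + 1)).
have e'0 : 0 < e' by rewrite divr_gt0// mulr_gt0 ?powR_gt0// ltr_wpDl.
have [N hNe] := hN _ e'0.
rewrite grid_esumE.
apply: (@le_trans _ _ (\sum_(W <- r) ((2 `^ p)%:E * ((m W `^ (- (s * p)))%:E * e'%:E) +
  (2 `^ p * C)%:E * \sum_(n <oo) (v n)%:E * ((m W `^ (- (s * p)))%:E *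
      pow_integral mu p (layer P c a (k + i + n)) W)))%E).
  rewrite big_seq [leRHS]big_seq; apply: lee_sum => W /mr mW.
  apply: (@le_trans _ _ ((m W `^ (- (s * p)))%:E * ((2 `^ p)%:E * (e'%:E +
     C%:E * \sum_(n <oo) (v n)%:E * pow_integral mu p (layer P c a (k + i + n)) W)))%E).
    apply: lee_wpmul2l; first by rewrite lee_fin powR_ge0.
    apply: le_trans (pow_integral_tail_le (k + i) N z0 C0 w0 hgeo mW mf) _.
    apply: lee_wpmul2l; first by rewrite lee_fin powR_ge0.
    apply: leeD => //; apply: le_trans hNe; apply: ge0_subset_integral => //.
      apply: measurable_pow_normc; apply: cmeasurableB => //.
      exact: cmeasurable_layers.
    by move=> x _; rewrite lee_fin powR_ge0.
  have s0 : (0 <= \sum_(n <oo) (v n)%:E *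
      pow_integral mu p (layer P c a (k + i + n)) W)%E.
    by apply: nneseries_ge0 => n _ _; rewrite mule_ge0 ?lee_fin ?pow_integral_ge0.
  rewrite muleCA ge0_muleDr ?lee_fin ?(ltW e'0)//; last first.
    by rewrite mule_ge0.
  rewrite ge0_muleDr; last 2 first.
  - by rewrite -EFinM lee_fin mulr_ge0 ?powR_ge0// ltW.
  - by rewrite !mule_ge0// lee_fin powR_ge0.
  apply: leeD => //; rewrite EFinM -muleA; apply: lee_wpmul2l.
    by rewrite lee_fin powR_ge0.
  rewrite muleCA; apply: lee_wpmul2l; first by rewrite lee_fin.
  under [leRHS]eq_eseriesr do rewrite muleCA.
  rewrite nneseriesZl// => n _.
  by rewrite mule_ge0 ?lee_fin ?pow_integral_ge0.
have t0 n W : (0 <= (v n)%:E * ((m W `^ (- (s * p)))%:E *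
    pow_integral mu p (layer P c a (k + i + n)) W))%E.
  by rewrite !mule_ge0 ?lee_fin ?powR_ge0 ?pow_integral_ge0.
rewrite big_split/= addeC; apply: leeD.
  rewrite -ge0_sume_distrr; last by move=> W _; apply: nneseries_ge0.
  apply: lee_wpmul2l; first by rewrite lee_fin mulr_ge0// powR_ge0.
  rewrite -nneseries_sum//; apply: lee_nneseries => [n _ _|n _].
    by rewrite sume_ge0.
  rewrite -ge0_sume_distrr; last first.
    by move=> W _; rewrite mule_ge0 ?lee_fin ?powR_ge0 ?pow_integral_ge0.
  have := layer_energy_le k (i + n); rewrite grid_esumE addnA.
  move=> /(lee_wpmul2l (x := (v n)%:E)); rewrite lee_fin => /(_ (v0 n))/le_trans; apply.
  rewrite muleA -EFinM; apply: lee_wpmul2r; first exact: coef_mass_ge0.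
  rewrite lee_fin /v -mulrA -[leRHS]mulr1 ler_wpM2l ?exprn_ge0//.
  rewrite exprD mulrCA -exprMn.
  have -> : z^-1 `^ p * l2 `^ (s * p) = 1.
    rewrite powRrM -/z -powRM ?invr_ge0 ?(ltW z0)//.
    by rewrite mulVf ?gt_eqF// powR1.
  rewrite expr1n mulr1 exprn_ile1 ?powR_ge0//.
  have -> : 1 = 1 `^ (s * p) :> R by rewrite powR1.
  by rewrite ge0_ler_powR ?nnegrE// ltW.
rewrite -ge0_sume_distrr; last first.
  by move=> W _; rewrite -EFinM lee_fin mulr_ge0 ?powR_ge0// ltW.
rewrite -ge0_sume_distrl; last by move=> W _; rewrite lee_fin powR_ge0.
rewrite sumEFin -/W0 -!EFinM lee_fin.
have W1 : 0 < W0 + 1 by rewrite ltr_wpDl.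
have -> : 2 `^ p * (W0 * e') = e * (W0 / (W0 + 1)).
  by rewrite /e'; field; rewrite !gt_eqF// powR_gt0.
by rewrite ger_pMr// ler_pdivrMr// mul1r lerDl.
Qed.

End layers.

(** * The cost controls the norm and the oscillation *)

Lemma grid_root : P 0%N setT. Proof. by rewrite (grid0 gridP). Qed.

Lemma root_weightK s p (x : \bar R) : (0 <= x)%E ->
  ((m setT `^ (s * p))%:E * ((m setT `^ (- (s * p)))%:E * x))%E = x.
Proof.
move=> x0; rewrite muleA -EFinM powRN mulfV ?mul1e//.
by rewrite gt_eqF// powR_gt0// (grid_fine_gt0 grid_root).
Qed.

Lemma cLnorm_cvg0 p (u : nat -> T -> R[i]) : 0 < p ->
  cLnorm mu p (u n) @[n --> \oo] --> 0%E ->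
  forall e, 0 < e -> exists N, forall n, (N <= n)%N ->
    (pow_integral mu p (u n) setT <= e%:E)%E.
Proof.
move=> p0 /fine_cvgP[fn cv] e e0.
have e'0 : 0 < e `^ p^-1 by rewrite powR_gt0.
have [N _ hN] : \forall n \near \oo, (cLnorm mu p (u n) <= (e `^ p^-1)%:E)%E.
  have lt0 := cvgr_lt _ cv _ e'0.
  near=> n; have fn' : cLnorm mu p (u n) \is a fin_num by near: n.
  rewrite -(fineK fn') lee_fin ltW//; near: n; exact: lt0.
exists N => n /hN /=; rewrite cLnormE => h.
have := poweR_le_pow p0 (pow_integral_ge0 mu p (u n) setT) h.
by rewrite poweR_EFin -powRrM mulVf ?gt_eqF// powRr1// ltW.
Unshelve. all: by end_near.
Qed.

Lemma besov_osc_ge0 s p q f : (0 <= besov_osc mu P s p q f)%E.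
Proof. exact: mixed_norm_ge0. Qed.

Lemma besov_cost_ge0 p q (c : nat -> set T -> R[i]) : (0 <= besov_cost P p q c)%E.
Proof. exact: mixed_norm_ge0. Qed.

Lemma osc_term_ge0 s p f k :
  (0 <= \sum_(Q \in P k) (m Q `^ (- (s * p)))%:E * osc mu p f Q `^ p)%E.
Proof.
rewrite grid_esumE sume_ge0// => Q _.
by rewrite mule_ge0 ?lee_fin ?powR_ge0 ?poweR_ge0.
Qed.

Lemma besov_osc_scale s p q K f1 f2 : 0 < p -> (1 <= q)%E -> 0 <= K ->
  (forall k Q, P k Q -> (osc mu p f1 Q <= K%:E * osc mu p f2 Q)%E) ->
  (besov_osc mu P s p q f1 <= K%:E * besov_osc mu P s p q f2)%E.
Proof.
move=> p0 q1 K0 f12.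
apply: mixed_norm_scale => // [k|k|k]; [exact: osc_term_ge0|exact: osc_term_ge0|].
rewrite [leRHS]grid_sum_distrr; last first.
  by move=> W; rewrite mule_ge0 ?lee_fin ?powR_ge0 ?poweR_ge0.
apply: grid_lee_sum => Q PQ.
rewrite muleCA; apply: lee_wpmul2l; first by rewrite lee_fin powR_ge0.
rewrite -poweR_EFin -poweRM ?lee_fin ?osc_ge0//.
by apply: le_poweR; rewrite ?osc_ge0 ?(ltW p0)//; exact: f12 PQ.
Qed.

Lemma besov_direct s p q : 0 < s -> 0 < p -> (1 <= q)%E ->
  exists2 C : R, 0 < C & forall f c a, cmeasurable f ->
    besov_rep mu P s p q f c a ->
    (cLnorm mu p f + besov_osc mu P s p q f <= C%:E * besov_cost P p q c)%E.
Proof.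
move=> s0 p0 q1.
have z01 : 0 < l2 `^ s < 1.
  rewrite powR_gt0//=; have -> : 1 = 1 `^ s :> R by rewrite powR1.
  by apply: gt0_ltr_powR => //; rewrite nnegrE ltW.
have [Cg [w [Cg0 /andP[w0 w1] hgeo]]] := geometric_poweR_le p0 z01.
have w01 : 0 < w < 1 by rewrite w0.
pose M := 2 `^ p * Cg.
have M0 : 0 < M by rewrite mulr_gt0// powR_gt0.
have mT0 : 0 < m setT `^ (s * p) by rewrite powR_gt0// (grid_fine_gt0 grid_root).
(* The oscillation at level k is bounded by masses from level k + 1 on; writing w^n = w^-1 w^(n+1)
   turns that series into part of the one starting at level k. *)
have Mw0 : 0 < M * w^-1 by rewrite mulr_gt0// invr_gt0.
have [C1 C10 hC1] := mixed_norm_geometric p0 q1 w01 Mw0.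
have [C2 C20 hC2] := mixed_norm_geometric p0 q1 w01 (mulr_gt0 mT0 M0).
exists (C2 + C1); first by rewrite addr_gt0.
move=> f c a mf [atoms _ cv _].
have b0 : forall k, (0 <= coef_mass p c k)%E by exact: coef_mass_ge0.
have tail u e : 0 < e -> exists N, (pow_integral mu p
    (fun x => f x - \sum_(0 <= j < u + N) layer P c a j x)%R setT <= e%:E)%E.
  move=> /(cLnorm_cvg0 p0 cv)[N hN]; exists N.
  by apply: hN; rewrite leq_addl.
have s1 u : (0 <= \sum_(n <oo) (w ^+ n)%:E * coef_mass p c (u + n)%N)%E.
  by apply: nneseries_ge0 => n _ _; rewrite mule_ge0// lee_fin exprn_ge0// ltW.
rewrite EFinD ge0_muleDl ?lee_fin ?(ltW C10) ?(ltW C20)//; apply: leeD.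
  (* Only [A 0] matters: it bounds the integral of |f|^p, its first factor undoing the weight of the
     root. The other entries let [mixed_norm_geometric] apply. *)
  pose A k := ((m setT `^ (s * p) * M)%:E *
    \sum_(n <oo) (w ^+ n)%:E * coef_mass p c (k + n)%N)%E.
  have A0 k : (0 <= A k)%E.
    by rewrite mule_ge0// lee_fin mulr_ge0 ?powR_ge0// ltW.
  apply: le_trans (hC2 A _ A0 b0 _) => //.
  apply: le_trans (mixed_norm_ge_term 0 p0 q1 A0).
  rewrite cLnormE; apply: le_poweR; rewrite ?invr_ge0 ?(ltW p0) ?pow_integral_ge0//.
  have := weighted_tail_le s0 p0 atoms (k := 0) (i := 0) (ltW Cg0) (ltW w0) hgeo mf
    (tail _).
  rewrite (grid0 gridP) fsbig_set1 addn0.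
  under [X in pow_integral _ _ X _]eq_fun do rewrite big_nil subr0.
  move=> /(lee_wpmul2l (x := (m setT `^ (s * p))%:E)).
  rewrite lee_fin => /(_ (ltW mT0)).
  by rewrite root_weightK ?pow_integral_ge0// muleA -EFinM.
apply: hC1 => //; first exact: osc_term_ge0.
move=> k; apply: (@le_trans _ _ (M%:E *
    \sum_(n <oo) (w ^+ n)%:E * coef_mass p c (k + 1 + n)%N)%E).
  apply: le_trans (weighted_tail_le s0 p0 atoms (k := k) (i := 1) (ltW Cg0) (ltW w0)
    hgeo mf (tail _)).
  apply: grid_lee_sum => W PW; apply: lee_wpmul2l; first by rewrite lee_fin powR_ge0.
  (* Positive measure provides a point [x0] of [W]; the value there of the partial sum, constant on
     [W], serves as the competitor in the oscillation. *)
  have := grid_gt0 gridP PW; have [->|/set0P[x0 Wx0] _] := eqVneq W set0.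
    by rewrite measure0 ltxx.
  apply: le_trans (osc_poweR_le mu f W (\sum_(0 <= j < k + 1) layer P c a j x0) p0) _.
  rewrite le_eqVlt; apply/orP; left; apply/eqP.
  apply: eq_integral => x; rewrite inE => Wx; congr ((normc (_ - _) `^ _)%:E).
  rewrite big_nat [RHS]big_nat; apply: eq_bigr => j /andP[_]; rewrite addn1 ltnS => jk.
  have PW' : P (j + (k - j))%N W by rewrite subnKC.
  by have := layer_constant c atoms PW' Wx0 Wx.
rewrite [(M * w^-1)%:E]EFinM -muleA; apply: lee_wpmul2l; first by rewrite lee_fin ltW.
rewrite -lee_pdivrMl ?invr_gt0// invrK -nneseriesZl; last first.
  by move=> n _; rewrite mule_ge0// lee_fin exprn_ge0// ltW.
have t0 n : (0 <= (w ^+ n)%:E * coef_mass p c (k + n)%N)%E.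
  by rewrite mule_ge0// lee_fin exprn_ge0// ltW.
apply: le_trans (nneseries_shift_le 1 t0).
apply: lee_nneseries => [n _ _|n _].
  by rewrite !mule_ge0// lee_fin ?exprn_ge0// ltW.
by rewrite muleA -EFinM -exprS -addnA add1n addn1.
Qed.

(** * From oscillation to atoms *)

Lemma grid_integralE k D (h : T -> \bar R) : measurable D ->
  measurable_fun D h -> (forall x, D x -> (0 <= h x)%E) ->
  (\int[mu]_(x in D) h x =
   \sum_(Q \in P k) \int[mu]_(x in Q `&` D) h x)%E.
Proof.
move=> mD mh h0; set r := fset_set (P k).
(* Again a default, here [set0], because measurability is required at every index. *)
pose F Q := if Q \in r then Q `&` D else set0.
have mF Q : measurable (F Q).
  rewrite /F; case: ifPn => // Qr; apply: measurableI => //.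
  by move: Qr; rewrite mem_grid inE => PQ; exact: (grid_measurable gridP PQ).
have UF : \big[setU/set0]_(Q <- r) F Q = D `\` ~` \bigcup_(Q in P k) Q.
  rewrite setDE setCK -bigcup_seq; apply/seteqP; split => x.
    move=> [Q /= Qr]; rewrite /F Qr => -[Qx Dx]; split => //; exists Q => //.
    by move: Qr; rewrite mem_grid inE.
  move=> [Dx [Q PQ Qx]]; have Qr : Q \in r by rewrite mem_grid inE.
  by exists Q => //; rewrite /F Qr.
have mU : measurable (~` \bigcup_(Q in P k) Q).
  apply: measurableC; apply: fin_bigcup_measurable; first exact: (grid_finite gridP k).
  by move=> Q PQ; exact: (grid_measurable gridP PQ).
have FE Q x : F Q x -> P k Q /\ Q x.
  rewrite /F; case: ifPn => // Qr [Qx _].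
  by move: Qr; rewrite mem_grid inE.
have tF : trivIset [set` r] F.
  by move=> Q W _ _ [x [/FE[PQ Qx] /FE[PW Wx]]]; exact: grid_same PQ PW Qx Wx.
have sFD : \big[setU/set0]_(Q <- r) F Q `<=` D by rewrite UF; exact: subDsetl.
rewrite (ge0_negligible_integral mU mD mh h0 (grid_cover gridP k)) -UF.
rewrite (ge0_integral_bigsetU mu mF _ tF)//.
- rewrite grid_esumE big_seq [RHS]big_seq; apply: eq_bigr => Q Qr.
  by rewrite /F Qr.
- exact: fset_uniq.
- exact: (measurable_funS mD sFD mh).
- by move=> x /sFD; exact: h0.
Qed.

Definition parent k Q := xget set0 [set W | P k W /\ Q `<=` W].

Lemma parentP k Q : P k.+1 Q -> P k (parent k Q) /\ Q `<=` parent k Q.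
Proof.
move=> /(grid_nested gridP)[W PW QW].
by apply: (xgetPex set0 (P := [set W | P k W /\ Q `<=` W])); exists W.
Qed.

Section synthesis.
Variables s p : R.
Hypotheses (s_gt0 : 0 < s) (p_gt0 : 0 < p).
Variables (f : T -> R[i]) (e : set T -> R[i]).
Hypothesis mf : cmeasurable f.
Hypothesis near_optimal : forall Q, measurable Q -> (0 < mu Q)%E ->
  (pow_integral mu p (fun x => f x - e Q)%R Q <=
    (2 `^ p)%:E * osc mu p f Q `^ p)%E.

Let p_ge0 : 0 <= p. Proof. exact: ltW. Qed.

(** The value 0 above the root makes the partial sums telescope to [e Q] itself. It is also why the
    L^p norm of [f], and not only its oscillation, bounds the cost. *)
Definition parent_value k Q : R[i] :=
  if k is k'.+1 then e (parent k' Q) else 0.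

(** The power of |Q| is inverse to the height of the atom, chosen maximal, so that coefficient times
    atom is exactly the jump from parent to cell. *)
Definition synthesis_coef k Q : R[i] :=
  (e Q - parent_value k Q) * (m Q `^ (p^-1 - s) +i* 0)%C.

Definition synthesis_atom (k : nat) Q (x : T) : R[i] :=
  (m Q `^ (s - p^-1) * \1_Q x +i* 0)%C.

Local Notation c := synthesis_coef.
Local Notation a := synthesis_atom.

Lemma synthesis_souza_atom k Q : P k Q -> souza_atom mu s p Q (a k Q).
Proof.
move=> PQ; split.
- exists (m Q `^ (s - p^-1) +i* 0)%C => x Qx.
  by rewrite /synthesis_atom indicE mem_set// mulr1.
- by move=> x Qx; rewrite /synthesis_atom indicE memNset// mulr0.
- move=> x; rewrite normc_real ?mulr_ge0 ?powR_ge0 ?indicE//.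
  by rewrite ler_piMr ?powR_ge0//; case: (x \in Q).
Qed.

Lemma synthesis_layer k Q x : P k Q -> Q x ->
  layer P c a k x = e Q - parent_value k Q.
Proof.
move=> PQ Qx; rewrite (layer_in (s := s) (p := p) _ _ PQ Qx)//; last first.
  exact: synthesis_souza_atom.
rewrite /synthesis_coef /synthesis_atom indicE mem_set// mulr1 -mulrA.
have -> : ((m Q `^ (p^-1 - s) +i* 0) * (m Q `^ (s - p^-1) +i* 0))%C = 1 :> R[i].
  apply/eqP; rewrite eq_complex /= !mulr0 mul0r subr0 addr0 eqxx andbT.
  rewrite -powRD ?subrKA ?subrr ?powRr0//.
  by rewrite (gt_eqF (grid_fine_gt0 PQ)) implybT.
by rewrite mulr1.
Qed.

Lemma synthesis_partial_sum n Q x : P n Q -> Q x ->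
  \sum_(0 <= k < n.+1) layer P c a k x = e Q.
Proof.
elim: n Q => [|n ih] Q PQ Qx.
  by rewrite big_nat1 (synthesis_layer PQ Qx)/= subr0.
have [PW QW] := parentP PQ.
by rewrite big_nat_recr//= (ih _ PW (QW _ Qx)) (synthesis_layer PQ Qx)/= addrC subrK.
Qed.

Lemma near_optimal_energy k :
  (\sum_(W \in P k) (m W `^ (- (s * p)))%:E *
     pow_integral mu p (fun x => f x - e W)%R W <=
   (2 `^ p)%:E * \sum_(W \in P k) (m W `^ (- (s * p)))%:E * osc mu p f W `^ p)%E.
Proof.
rewrite [leRHS]grid_sum_distrr; last first.
  by move=> W; rewrite mule_ge0 ?lee_fin ?powR_ge0 ?poweR_ge0.
apply: grid_lee_sum => W PW.
rewrite muleCA; apply: lee_wpmul2l; first by rewrite lee_fin powR_ge0.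
by apply: near_optimal; [exact: (grid_measurable gridP PW)|exact: (grid_gt0 gridP PW)].
Qed.

(** The weights have a negative exponent, so a lower bound |Q| >= l1 |W| is what compares them; the
    integrals over the children then add up to the integral over the parent. *)
Lemma parent_energy k :
  (\sum_(Q \in P k.+1) (m Q `^ (- (s * p)))%:E *
     pow_integral mu p (fun x => f x - e (parent k Q))%R Q <=
   (l1 `^ (- (s * p)))%:E * \sum_(W \in P k) (m W `^ (- (s * p)))%:E *
     pow_integral mu p (fun x => f x - e W)%R W)%E.
Proof.
pose h W x : \bar R := ((normc (f x - e W)) `^ p)%:E.
have h0 W x : (0 <= h W x)%E by rewrite lee_fin powR_ge0.
have mh D W : measurable_fun D (h W).
  by apply: measurable_pow_normc; exact: cmeasurableB (cmeasurable_cst _ _).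
have j0 D W : (0 <= \int[mu]_(x in D) h W x)%E by exact: integral_ge0.
rewrite [leRHS]grid_sum_distrr; last first.
  by move=> W; rewrite mule_ge0 ?lee_fin ?powR_ge0 ?pow_integral_ge0.
(* A double sum over Q and W, in which only the parent of Q contributes, replaces sums over
   children; after the exchange [grid_integralE] reassembles the integral over W. *)
apply: (@le_trans _ _ (\sum_(Q \in P k.+1) \sum_(W \in P k)
    (l1 `^ (- (s * p)) * m W `^ (- (s * p)))%:E * \int[mu]_(x in Q `&` W) h W x)%E).
  apply: grid_lee_sum => Q PQ.
  have [PW QW] := parentP PQ; set W := parent k Q in PW QW *.
  rewrite (@grid_sum_single _ _ _ k W _ PW); last first.
    move=> W' PW' W'W; have -> : Q `&` W' = set0.
      apply/seteqP; split => // x [Qx W'x]; apply: W'W.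
      exact: grid_same PW' PW W'x (QW _ Qx).
    by rewrite integral_set0 mule0.
  rewrite setIidl//; apply: lee_wpmul2r; first exact: j0.
  have mW := grid_fine_gt0 PW; have mQ := grid_fine_gt0 PQ.
  rewrite lee_fin -powRM ?(ltW l1_gt0) ?(ltW mW)// !powRN.
  rewrite lef_pV2 ?posrE ?powR_gt0 ?mulr_gt0//.
  apply: ge0_ler_powR; rewrite ?nnegrE ?mulr_ge0 ?(ltW l1_gt0) ?(ltW mW) ?(ltW mQ)//.
    exact: ltW.
  have /andP[+ _] := grid_ratio gridP PQ PW QW.
  by rewrite ler_pdivlMr.
rewrite [leLHS]grid_esumE; under eq_bigr do rewrite grid_esumE.
rewrite exchange_big/= [leRHS]grid_esumE big_seq [leRHS]big_seq; apply: lee_sum => W.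
rewrite mem_grid inE => PW.
rewrite -ge0_sume_distrr// muleA -EFinM; apply: lee_wpmul2l.
  by rewrite lee_fin mulr_ge0 ?powR_ge0.
have mW := grid_measurable gridP PW.
have := grid_integralE k.+1 mW (mh W W) (fun x _ => h0 W x).
by rewrite grid_esumE => <-.
Qed.

(** By the normalisation, |c Q|^p is |Q|^(-sp) times the integral over Q of the p-th power of the
    constant jump; comparing both constants with [f] splits it. *)
Lemma synthesis_coef_mass k : (coef_mass p c k <= (2 `^ p)%:E *
  (\sum_(Q \in P k) (m Q `^ (- (s * p)))%:E *
     pow_integral mu p (fun x => f x - e Q)%R Q +
   \sum_(Q \in P k) (m Q `^ (- (s * p)))%:E *
     pow_integral mu p (fun x => f x - parent_value k Q)%R Q))%E.
Proof.
rewrite /coef_mass [leLHS]grid_esumE [X in (_ * (X + _))%E]grid_esumE.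
rewrite [X in (_ * (_ + X))%E]grid_esumE -big_split/= ge0_sume_distrr; last first.
  by move=> Q _; rewrite adde_ge0// mule_ge0 ?lee_fin ?powR_ge0 ?pow_integral_ge0.
rewrite big_seq [leRHS]big_seq; apply: lee_sum => Q; rewrite mem_grid inE => PQ.
have mQ := grid_measurable gridP PQ; have Q0 := grid_fine_gt0 PQ.
have -> : ((normc (c k Q) `^ p)%:E = (m Q `^ (- (s * p)))%:E *
    pow_integral mu p (fun x => e Q - parent_value k Q)%R Q)%E.
  rewrite pow_integral_cst// (measure_fine mQ) -!EFinM; congr EFin.
  rewrite /c ComplexField.Normc.normcM normc_real ?powR_ge0//.
  rewrite powRM ?normc_ge0 ?powR_ge0// -powRrM mulrBl mulVf ?gt_eqF//.
  rewrite mulrCA; congr (_ * _).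
  rewrite -[X in _ = _ * X]powRr1 ?(ltW Q0)// -powRD; last by rewrite (gt_eqF Q0) implybT.
  by rewrite addrC.
rewrite -ge0_muleDr ?pow_integral_ge0// muleCA.
apply: lee_wpmul2l; first by rewrite lee_fin powR_ge0.
apply: le_trans (pow_integralB_le mu p_ge0 mQ (cmeasurable_cst T (e Q))
  (cmeasurable_cst T (parent_value k Q)) mf) _.
apply: lee_wpmul2l; first by rewrite lee_fin powR_ge0.
apply: leeD => //; rewrite /pow_integral.
by under eq_integral do rewrite normc_distC.
Qed.

(** On a cell Q of level n the partial sum is [e Q], and |Q| <= l2^n |T| shows that the unweighted
    energy is smaller than the weighted one by the factor |T|^(sp) l2^(spn). *)
Lemma synthesis_tail n :
  (pow_integral mu p (fun x => f x - \sum_(0 <= k < n.+1) layer P c a k x)%R setT <=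
   (m setT `^ (s * p) * (l2 `^ (s * p)) ^+ n * 2 `^ p)%:E *
   \sum_(W \in P n) (m W `^ (- (s * p)))%:E * osc mu p f W `^ p)%E.
Proof.
have mT0 := grid_fine_gt0 grid_root.
rewrite /pow_integral (grid_integralE n)//; last 2 first.
- apply: measurable_pow_normc; apply: cmeasurableB => //.
  by apply: (cmeasurable_layers (s := s) (p := p)) => k Q; exact: synthesis_souza_atom.
- by move=> x _; rewrite lee_fin powR_ge0.
have wE : 0 <= m setT `^ (s * p) * (l2 `^ (s * p)) ^+ n.
  by rewrite mulr_ge0 ?exprn_ge0 ?powR_ge0.
rewrite EFinM -muleA.
apply: le_trans (lee_wpmul2l _ (near_optimal_energy n)); last by rewrite lee_fin.
rewrite [leRHS]grid_sum_distrr; last first.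
  by move=> W; rewrite mule_ge0 ?lee_fin ?powR_ge0 ?pow_integral_ge0.
apply: grid_lee_sum => Q PQ.
rewrite setIT muleA -EFinM.
have -> : (\int[mu]_(x in Q)
    (normc (f x - \sum_(0 <= k < n.+1) layer P c a k x) `^ p)%:E =
    pow_integral mu p (fun x => f x - e Q)%R Q)%E.
  by apply: eq_integral => x; rewrite inE => Qx; rewrite (synthesis_partial_sum PQ).
rewrite -[leLHS]mul1e; apply: lee_wpmul2r; first exact: pow_integral_ge0.
have mQ := grid_fine_gt0 PQ.
have [W [+ _ +]] := grid_ancestor (k := 0) PQ.
rewrite (grid0 gridP) => -> h.
rewrite lee_fin powRN ler_pdivlMr ?powR_gt0// mul1r -powR_exprn ?(ltW l2_gt0)//.
rewrite [leRHS]mulrC -powRM ?exprn_ge0 ?(ltW l2_gt0) ?(ltW mT0)//.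
apply: ge0_ler_powR.
- by rewrite mulr_ge0// ltW.
- by rewrite nnegrE ltW.
- by rewrite nnegrE mulr_ge0 ?exprn_ge0 ?(ltW l2_gt0) ?(ltW mT0).
- by [].
Qed.

End synthesis.

(** This is [layer_energy_le] seen from the root. The decay in [k] yields the absolute convergence
    in L^p demanded by [besov_rep]. *)
Lemma cLnorm_layer_le s p q (c : nat -> set T -> R[i]) a k :
  0 < s -> 0 < p -> (1 <= q)%E ->
  (forall k Q, P k Q -> souza_atom mu s p Q (a k Q)) ->
  (cLnorm mu p (layer P c a k) <=
    (m setT `^ s * (l2 `^ s) ^+ k)%:E * besov_cost P p q c)%E.
Proof.
move=> s0 p0 q1 atoms; have b0 := coef_mass_ge0 p c.
apply: (@le_trans _ _ ((m setT `^ s * (l2 `^ s) ^+ k)%:E * coef_mass p c k `^ p^-1)%E).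
  have := layer_energy_le c s0 p0 atoms 0 k.
  rewrite add0n (grid0 gridP) fsbig_set1 -/(coef_mass p c k).
  move=> /(lee_wpmul2l (x := (m setT `^ (s * p))%:E)).
  rewrite lee_fin powR_ge0 root_weightK ?pow_integral_ge0// => /(_ isT).
  rewrite cLnormE => /le_poweR => /(_ p^-1); rewrite invr_ge0 (ltW p0).
  move=> /(_ isT (pow_integral_ge0 _ _ _ _))/le_trans; apply.
  rewrite muleA -EFinM poweRM ?lee_fin ?mulr_ge0 ?exprn_ge0 ?powR_ge0//.
  rewrite poweR_EFin powRM ?exprn_ge0 ?powR_ge0// powR_exprn ?powR_ge0//.
  by rewrite -!powRrM mulfK ?gt_eqF.
apply: lee_wpmul2l; first by rewrite lee_fin mulr_ge0 ?exprn_ge0 ?powR_ge0.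
exact: (mixed_norm_ge_term k p0 q1 b0).
Qed.

Lemma synthesis_cost s p q : 0 < s -> 0 < p -> (1 <= q)%E ->
  exists2 C : R, 0 < C & forall f e, cmeasurable f ->
    (forall Q, measurable Q -> (0 < mu Q)%E ->
      (pow_integral mu p (fun x => f x - e Q)%R Q <=
        (2 `^ p)%:E * osc mu p f Q `^ p)%E) ->
    (besov_cost P p q (synthesis_coef s p e) <=
      C%:E * (cLnorm mu p f + besov_osc mu P s p q f))%E.
Proof.
move=> s0 p0 q1.
(* The ratio is artificial: the mass at level k involves only [D k] and [D k.+1], and D k + D k.+1
   <= 2 (D k + D k.+1 / 2). This also explains [A * 2]. *)
have half : 0 < (2^-1 : R) < 1 by rewrite invr_gt0 ltr0n invf_lt1 ?ltr1n ?ltr0n.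
(* The outer 2^p comes from [synthesis_coef_mass]. Inside, the terms account for the constant on the
   cell itself, the value 0 above the root, and the constant on the parent. *)
pose A := 2 `^ p * (2 `^ p + m setT `^ (- (s * p)) + l1 `^ (- (s * p)) * 2 `^ p).
have p2 : 0 < 2 `^ p :> R by rewrite powR_gt0.
have wT : 0 <= m setT `^ (- (s * p)) by rewrite powR_ge0.
have w1 : 0 <= l1 `^ (- (s * p)) by rewrite powR_ge0.
have A0 : 0 < A.
  by rewrite mulr_gt0// -addrA ltr_pwDl// addr_ge0// mulr_ge0// ltW.
have A20 : 0 < A * 2 by rewrite mulr_gt0.
have [C1 C10 hC1] := mixed_norm_geometric p0 q1 half A20.
have [C2 C20 hC2] := mixed_norm_cons p0 q1.
exists (C1 * C2); first by rewrite mulr_gt0.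
move=> f e mf he.
pose O k := (\sum_(W \in P k) (m W `^ (- (s * p)))%:E * osc mu p f W `^ p)%E.
have O0 k : (0 <= O k)%E by exact: osc_term_ge0.
(* Indices are shifted by one: [D k] is the energy attached to the parents of the cells of level k,
   and the integral of |f|^p stands in for the missing parent of the root. *)
pose D k := if k is k'.+1 then O k' else pow_integral mu p f setT.
have D0 k : (0 <= D k)%E by case: k => [|k] /=; [exact: pow_integral_ge0|exact: O0].
apply: (@le_trans _ _ (C1%:E * mixed_norm p q D)%E); last first.
  rewrite EFinM -muleA; apply: lee_wpmul2l; first by rewrite lee_fin ltW.
  by rewrite cLnormE; exact: hC2.
apply: hC1 => // [k|k]; first exact: coef_mass_ge0.
have energy := near_optimal_energy s he.
have key : (coef_mass p (synthesis_coef s p e) k <= A%:E * (D k + D k.+1))%E.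
  apply: le_trans (synthesis_coef_mass s p0 e mf k) _.
  rewrite [A%:E]EFinM -muleA; apply: lee_wpmul2l; first by rewrite lee_fin ltW.
  rewrite addeC ge0_muleDr//; apply: leeD; last first.
    apply: le_trans (energy k) _; apply: lee_wpmul2r; first exact: (O0 k).
    by rewrite lee_fin -addrA lerDl addr_ge0// mulr_ge0// ltW.
  case: k => [|k].
    rewrite (grid0 gridP) fsbig_set1 /=.
    under [X in pow_integral _ _ X _]eq_fun do rewrite subr0.
    apply: lee_wpmul2r; first exact: pow_integral_ge0.
    rewrite lee_fin; have : 0 <= l1 `^ (- (s * p)) * 2 `^ p by rewrite mulr_ge0// ltW.
    lra.
  apply: le_trans (parent_energy s0 p0 e mf k) _.
  apply: le_trans (lee_wpmul2l _ (energy k)) _; first by rewrite lee_fin.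
  rewrite muleA -EFinM; apply: lee_wpmul2r; first exact: (O0 k).
  by rewrite lee_fin lerDr addr_ge0// ltW.
apply: (le_trans key); rewrite [X in (_ <= X * _)%E]EFinM -muleA.
apply: lee_wpmul2l; first by rewrite lee_fin ltW.
have t0 n : (0 <= (2^-1 ^+ n)%:E * D (k + n)%N)%E.
  by rewrite mule_ge0// lee_fin exprn_ge0// invr_ge0.
apply: (@le_trans _ _ (2%:E * \sum_(0 <= n < 2) (2^-1 ^+ n)%:E * D (k + n)%N)%E).
  rewrite big_nat_recr//= big_nat1 expr0 expr1 addn0 mul1e addn1.
  rewrite ge0_muleDr ?mule_ge0 ?lee_fin ?invr_ge0//.
  rewrite muleA -EFinM mulfV ?pnatr_eq0// mul1e leeD2r//.
  by rewrite -[leLHS]mul1e lee_wpmul2r// lee_fin; lra.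
by apply: lee_wpmul2l; [rewrite lee_fin|exact: nneseries_lim_ge].
Qed.

Lemma besov_converse s p q : 0 < s -> 0 < p -> (1 <= q)%E ->
  exists2 C : R, 0 < C & forall f, cLp mu p f ->
    (besov_osc mu P s p q f < +oo)%E ->
    exists c a, besov_rep mu P s p q f c a /\
      (besov_cost P p q c <= C%:E * (cLnorm mu p f + besov_osc mu P s p q f))%E.
Proof.
move=> s0 p0 q1; have [C C0 hC] := synthesis_cost s0 p0 q1; exists C => //.
move=> f [mf fy] oy.
(* Constants are chosen for all sets at once; sets that are not measurable or have measure zero
   receive 0. *)
have /choice[e he] : forall Q, exists c, measurable Q -> (0 < mu Q)%E ->
    (pow_integral mu p (fun x => f x - c)%R Q <= (2 `^ p)%:E * osc mu p f Q `^ p)%E.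
  move=> Q; have [mQ|mQ] := pselect (measurable Q); last by exists 0.
  have [Q0|Q0] := ltP 0%E (mu Q); last by exists 0.
  by have [c hc] := osc_near_optimal p0 mf mQ Q0; exists c.
exists (synthesis_coef s p e), (synthesis_atom s p).
have hcost := hC f e mf he; split => //.
have costy : (besov_cost P p q (synthesis_coef s p e) < +oo)%E.
  apply: le_lt_trans hcost _; apply: lte_mul_pinfty.
  - by rewrite lee_fin ltW.
  - by [].
  - exact: lte_add_pinfty.
have cfin : besov_cost P p q (synthesis_coef s p e) \is a fin_num.
  by rewrite ge0_fin_numE// besov_cost_ge0.
have ofin : besov_osc mu P s p q f \is a fin_num.
  by rewrite ge0_fin_numE// besov_osc_ge0.
have mT0 := grid_fine_gt0 grid_root.
have ls0 : 0 < l2 `^ s by rewrite powR_gt0.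
have ls1 : l2 `^ s < 1.
  have -> : 1 = 1 `^ s :> R by rewrite powR1.
  by apply: gt0_ltr_powR => //; rewrite nnegrE ltW.
have atoms := synthesis_souza_atom s p.
split => //.
- apply: (@le_lt_trans _ _ (\sum_(k <oo)
    (m setT `^ s * fine (besov_cost P p q (synthesis_coef s p e)))%:E *
      ((l2 `^ s) ^+ k)%:E)%E).
    apply: lee_nneseries => [k _ _|k _]; first exact: Lnorm_ge0.
    apply: le_trans (cLnorm_layer_le (synthesis_coef s p e) k s0 p0 q1 atoms) _.
    by rewrite -(fineK cfin) -!EFinM lee_fin/= mulrAC.
  rewrite nneseriesZl; last by move=> k _; rewrite lee_fin exprn_ge0// ltW.
  by rewrite nneseries_geometric// ?ltry// ltW.
(* [synthesis_tail] concerns sums of n.+1 layers, so the empty partial sum is dropped before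
   squeezing. *)
- set u := (X in X @ _ --> _); rewrite -cvg_shiftS.
  pose K := 2 * m setT `^ s * fine (besov_osc mu P s p q f).
  have K0 : 0 <= K by rewrite !mulr_ge0 ?powR_ge0// fine_ge0// besov_osc_ge0.
  pose h n : \bar R := (K * (l2 `^ s) ^+ n)%:E.
  have uh n : (cst 0 n <= u n.+1 <= h n)%E.
    rewrite Lnorm_ge0 /u cLnormE.
    have := synthesis_tail s0 p0 mf he n.
    move=> /(le_poweR _ (pow_integral_ge0 _ _ _ _)) -/(_ p^-1); rewrite invr_ge0 (ltW p0).
    move=> /(_ isT)/le_trans; apply.
    rewrite poweRM ?osc_term_ge0//; last first.
      by rewrite lee_fin !mulr_ge0 ?exprn_ge0 ?powR_ge0.
    rewrite poweR_EFin !powRM ?mulr_ge0 ?exprn_ge0 ?powR_ge0// powR_exprn ?powR_ge0//.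
    rewrite -!powRrM mulfV ?gt_eqF// powRr1// mulfK ?gt_eqF//.
    have := mixed_norm_ge_term n p0 q1 (osc_term_ge0 s p f).
    rewrite -/(besov_osc mu P s p q f) -(fineK ofin).
    move=> /(lee_wpmul2l (x := (m setT `^ s * l2 `^ s ^+ n * 2)%:E)) -/(_ _)/le_trans.
    rewrite lee_fin !mulr_ge0 ?exprn_ge0 ?powR_ge0// => /(_ _ isT); apply.
    by rewrite -EFinM lee_fin /K le_eqVlt; apply/orP; left; apply/eqP; ring.
  have h0 : h n @[n --> \oo] --> 0%E.
    apply: cvg_EFin; first exact: nearW.
    by apply: cvg_geometric; rewrite ger0_norm// ltW.
  exact: (squeeze_cvge (nearW _ uh) (cvg_cst _) h0).
Qed.

End grid_theory.

(** * Composition with a Lipschitz function *)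

Section lipschitz_composition.
Context (R : realType).
Variable g : R[i] -> R[i].
Hypothesis lip : lipschitz_bounds g !=set0.

Lemma lipschitz_bounds_ge0 k : lipschitz_bounds g k -> 0 <= k.
Proof.
move=> /(_ 1 0); rewrite subr0 ComplexField.Normc.normc1 mulr1.
exact: le_trans (normc_ge0 _).
Qed.

Lemma lipschitz_constant_ge0 : 0 <= lipschitz_constant g.
Proof. by apply: lb_le_inf => // k; exact: lipschitz_bounds_ge0. Qed.

(** The infimum is attained: for z <> w the difference quotient is a lower bound of the set of
    Lipschitz bounds. *)
Lemma lipschitz_constantP : lipschitz_bounds g (lipschitz_constant g).
Proof.
move=> z w; have [->|zw] := eqVneq z w.
  by rewrite !subrr ComplexField.Normc.normc0 mulr0.
have zw0 : 0 < normc (z - w).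
  rewrite lt_def normc_ge0 andbT; apply: contra zw => /eqP.
  by move=> /ComplexField.Normc.eq0_normc/eqP; rewrite subr_eq0.
rewrite -ler_pdivrMr//; apply: lb_le_inf => // k kg.
by rewrite ler_pdivrMr//; exact: kg.
Qed.

End lipschitz_composition.

Section lipschitz_besov.
Context d (T : measurableType d) (R : realType).
Variables (mu : {finite_measure set T -> \bar R}) (P : nat -> set (set T)).
Variables (l1 l2 s p K : R) (q : \bar R) (g : R[i] -> R[i]) (f : T -> R[i]).
Hypothesis gridP : is_grid mu l1 l2 P.
Hypotheses (p_gt0 : 0 < p) (q_ge1 : (1 <= q)%E) (K_ge0 : 0 <= K).
Hypotheses (gK : lipschitz_bounds g K) (mf : cmeasurable f).

Lemma cLnorm_lipschitz : g 0 = 0 ->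
  (cLnorm mu p (g \o f) <= K%:E * cLnorm mu p f)%E.
Proof.
move=> g0; rewrite !cLnormE.
have -> : K%:E = ((K `^ p)%:E `^ p^-1)%E.
  by rewrite poweR_EFin -powRrM mulfV ?gt_eqF// powRr1.
rewrite -poweRM ?lee_fin ?powR_ge0 ?pow_integral_ge0//.
apply: le_poweR; rewrite ?pow_integral_ge0 ?invr_ge0 ?(ltW p_gt0)//.
apply: pow_integral_le => //; first exact: ltW.
- exact: cmeasurable_lipschitz_comp gK mf.
- by move=> x _; have := gK (f x) 0; rewrite g0 !subr0.
Qed.

Lemma besov_osc_lipschitz :
  (besov_osc mu P s p q (g \o f) <= K%:E * besov_osc mu P s p q f)%E.
Proof.
apply: (besov_osc_scale gridP) => // k Q PQ.
by apply: osc_lipschitz => //; exact: (grid_measurable gridP PQ).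
Qed.

End lipschitz_besov.

Theorem proposition21p1 (d : measure_display) (T : measurableType d)
    (R : realType) (mu : {finite_measure set T -> \bar R})
    (P : nat -> set (set T)) (hP : good_grid mu P)
    (p : R) (hp : 1 <= p) (q : \bar R) (hq : (1 <= q)%E)
    (s : R) (hs0 : 0 < s) (hsp : s < p^-1)
    (g : R[i] -> R[i]) (hg : lipschitz_bounds g !=set0) (hg0 : g 0 = 0) :
  [/\ (forall f, besov mu P s p q f -> besov mu P s p q (g \o f)) /\
      (forall f1 f2, besov mu P s p q f1 -> besov mu P s p q f2 ->
        f1 = f2 %[ae mu] -> g \o f1 = g \o f2 %[ae mu]),
      (forall f, besov mu P s p q f ->
        (cLnorm mu p (g \o f) + besov_osc mu P s p q (g \o f) <=
         (lipschitz_constant g)%:E *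
           (cLnorm mu p f + besov_osc mu P s p q f))%E) &
      exists C : R, forall f, besov mu P s p q f ->
        (besov_norm mu P s p q (g \o f) <= C%:E * besov_norm mu P s p q f)%E].
Proof.
have [l1 [l2 [l10 l12 l21 gridP]]] := hP.
have p0 : 0 < p by exact: lt_le_trans hp.
have K0 := lipschitz_constant_ge0 hg; have gK := lipschitz_constantP hg.
set K := lipschitz_constant g in K0 gK *.
have [C1 C10 direct] := besov_direct l10 l12 l21 gridP hs0 p0 hq.
have [C2 C20 converse] := besov_converse l10 l12 l21 gridP hs0 p0 hq.
pose N f := (cLnorm mu p f + besov_osc mu P s p q f)%E.
have o0 f : (0 <= besov_osc mu P s p q f)%E by exact: besov_osc_ge0.
have n0 f : (0 <= cLnorm mu p f)%E by exact: Lnorm_ge0.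
have gN f : cmeasurable f -> (N (g \o f) <= K%:E * N f)%E.
  move=> mf; rewrite /N ge0_muleDr//.
  by apply: leeD; [exact: cLnorm_lipschitz|exact: (besov_osc_lipschitz s gridP)].
have oy f : besov mu P s p q f -> (N f < +oo)%E.
  move=> [[mf _] [c [a fca]]]; apply: le_lt_trans (direct _ _ _ mf fca) _.
  have [_ _ _ cy] := fca; apply: lte_mul_pinfty => //.
  by rewrite lee_fin ltW.
have gLp f : besov mu P s p q f ->
    cLp mu p (g \o f) /\ (besov_osc mu P s p q (g \o f) < +oo)%E.
  move=> Bf; have [[mf _] _] := Bf.
  have Ngy : (N (g \o f) < +oo)%E.
    apply: le_lt_trans (gN _ mf) _; apply: lte_mul_pinfty; rewrite ?lee_fin//.
    exact: oy.
  split; last by apply: le_lt_trans Ngy; rewrite leeDr.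
  split; first exact: cmeasurable_lipschitz_comp gK mf.
  by apply: le_lt_trans Ngy; rewrite leeDl.
split.
- split=> [f Bf|f1 f2 _ _]; last by apply: filterS => x /= h Tx; rewrite h.
  have [Lgf ogf] := gLp f Bf; split => //.
  by have [c [a [ca _]]] := converse _ Lgf ogf; exists c, a.
- by move=> f [[mf _] _]; exact: gN.
(* From the cost of [f] to norm plus oscillation ([C1]), through the composition ([K]), and back to
   the cost of a new representation ([C2]). *)
exists (C2 * K * C1) => f Bf; have [[mf _] _] := Bf.
have [Lgf ogf] := gLp f Bf; have [c [a [ca hc]]] := converse _ Lgf ogf.
apply: (@le_trans _ _ (besov_cost P p q c)).
  by apply: ereal_inf_lbound; exists c, a.
apply: (le_trans hc); rewrite !EFinM -!muleA; apply: lee_wpmul2l.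
  by rewrite lee_fin ltW.
apply: le_trans (gN _ mf) _; apply: lee_wpmul2l; rewrite ?lee_fin//.
(* [direct] holds for each representation of [f]; division by [C1] lets the infimum over all of them
   be taken. *)
rewrite -lee_pdivrMl//; apply/ereal_infP => _ [c' [a' [fca ->]]].
by rewrite lee_pdivrMl//; exact: direct fca.
Qed.
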